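(* Let $A:\mathbb{R}^n\to\mathbb{R}^m$ be linear, let $f:\mathbb{R}^n\to\mathbb{R}\cup\{\infty\}$ be proper, closed and strongly convex with modulus $\mu_f>0$, let $g:\mathbb{R}^m\to\mathbb{R}\cup\{\infty\}$ be proper, closed and convex, with $A\,\mathrm{dom}\, f\cap\mathrm{dom}\, g\neq\emptyset$. Let $x_\star$ be the unique minimizer of $f+g\circ A$ and let $\psi(y)=f^*(-A^\top y)+g^*(y)$. Suppose that $\psi$ has a (unique) strong minimizer $y_\star$ and that, with respect to the primal-dual solution $(x_\star,y_\star)$: (a) $f$ is strictly twice epi-differentiable at all $x\in\mathrm{dom}\, f$ close enough to $x_\star$, and its second-order epi-derivative at $x_\star$ for $-A^\top y_\star$ is $w\mapsto\langle H_fw,w\rangle+\delta_{S_f}(w)$, with $S_f\subseteq\mathbb{R}^n$ a linear subspace and $H_f\in\mathbb{R}^{n\times n}$ symmetric positive semidefinite, $\mathrm{range}(H_f)=S_f$, $\ker(H_f)=S_f^\perp$; (b) $g$ is strictly twice epi-differentiable at $Ax_\star$ for $y_\star$, with second-order epi-derivative $w\mapsto\langle H_gw,w\rangle+\delta_{S_g}(w)$, with $S_g\subseteq\mathbb{R}^m$ a linear subspace and $H_g\in\mathbb{R}^{m\times m}$ symmetric positive semidefinite, $\mathrm{range}(H_g)\subseteq S_g$, $\ker(H_g)\supseteq S_g^\perp$. Let $(x^k),(z^k),(y^k),(\tau_k)$ be generated by the algorithm NAMA (described in the context), with $\gamma\in(0,\mu_f/\|A\|^2)$, $\beta\in(0,1)$,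 $y^0\in\mathbb{R}^m$, and directions $d^k=B_k^{-1}(Ax^k-z^k)$ for a sequence of nonsingular matrices $B_k\in\mathbb{R}^{m\times m}$ satisfying $$\lim_{k\to\infty}\frac{\|(B_k-JR_\gamma(y_\star))d^k\|}{\|d^k\|}=0 .$$ Then $(d^k)$ is superlinearly convergent with respect to $(y^k)$, i.e. $\lim_{k\to\infty}\|y^k+d^k-y_\star\|/\|y^k-y_\star\|=0$. In particular: $\tau_k=1$ for all $k$ sufficiently large; $\psi(y^k)\to\inf\psi$ Q-superlinearly; $y^k\to y_\star$ Q-superlinearly; and $x^k\to x_\star$ R-superlinearly.
   Context: $A^\top$ is the adjoint; $\|A\|$ the operator norm; $h^*$ the Fenchel conjugate; $\delta_S$ the indicator function of $S$ ($0$ on $S$, $\infty$ elsewhere); strong convexity of $f$ with modulus $\mu_f$ means $f-\frac{\mu_f}{2}\|\cdot\|^2$ is convex. $y_\star$ is a strong minimizer of $\psi$ if for some $\alpha>0$, $\alpha\|y-y_\star\|^2\le\psi(y)-\psi(y_\star)$ for all $y$ sufficiently close to $y_\star$. Augmented Lagrangian: $\mathcal{L}_\gamma(x,z,y)=f(x)+g(z)+\langle y,Ax-z\rangle+\frac{\gamma}{2}\|Ax-z\|^2$. Define $x(y)=\arg\min_x\{f(x)+\langle y,Ax\rangle\}$, $z_\gamma(y)=\arg\min_z\mathcal{L}_\gamma(x(y),z,y)$, $R_\gamma(y)=z_\gamma(y)-Ax(y)$; $JR_\gamma(y_\star)$ is the Jacobian of $R_\gamma$ at $y_\star$ (it exists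 under the hypotheses). Twice epi-differentiability: $h$ is twice epi-differentiable at $x$ for $v$ if the quotients $d\mapsto\frac{h(x+\tau d)-h(x)-\tau\langle v,d\rangle}{\tau^2/2}$ epi-converge (epigraphs converge in the Painlevé–Kuratowski sense) as $\tau\searrow0$; the limit function of $d$ is the second-order epi-derivative of $h$ at $x$ for $v$. It is strictly twice epi-differentiable at $x$ for $v$ if the quotients $d\mapsto\frac{h(\bar x+\tau d)-h(\bar x)-\tau\langle\bar v,d\rangle}{\tau^2/2}$ epi-converge as $\tau\searrow0$, $\bar x\to x$, $\bar v\to v$ (with $\bar v\in\partial h(\bar x)$). ''Strictly twice epi-differentiable at $x$'' without mention of $v$ means for every $v\in\partial f(x)$. Algorithm NAMA. Given $y^0\in\mathbb{R}^m$, $\gamma\in(0,\mu_f/\|A\|^2)$, $\beta\in(0,1)$, for $k=0,1,2,\dots$: 1. $x^k=\arg\min_x\{f(x)+\langle y^k,Ax\rangle\}$, $z^k=\arg\min_z\mathcal{L}_\gamma(x^k,z,y^k)$. 2. Choose a direction $d^k\in\mathbb{R}^m$. 3. Find the largest $\tau_k=\beta^{i_k}$, $i_k\in\{0,1,2,\dots\}$, such that $\mathcal{L}_\gamma(\tilde x^k,\tilde z^k,\tilde y^k)\ge\mathcal{L}_\gamma(x^k,z^k,y^k)$, where $\tilde y^k=y^k+\tau_kd^k+\gamma(1-\tau_k)(Ax^k-z^k)$, $\tilde x^k=\arg\min_x\{f(x)+\langle\tilde y^k,Ax\rangle\}$, $\tilde z^k=\arg\min_z\mathcal{L}_\gamma(\tilde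 x^k,z,\tilde y^k)$. 4. $y^{k+1}=\tilde y^k+\gamma(A\tilde x^k-\tilde z^k)$. Such a $\tau_k$ exists whenever $Ax^k\neq z^k$; if $Ax^k=z^k$ then $(x^k,y^k)$ is already a primal-dual solution. The statement concerns infinite sequences with $Ax^k\neq z^k$ (equivalently $y^k\ne y_\star$) for all $k$. Rates: $a_k\ge0$ tends to $0$ Q-superlinearly if $a_{k+1}/a_k\to0$ (applied to $\psi(y^k)-\inf\psi$ and to $\|y^k-y_\star\|$); $x^k\to x_\star$ R-superlinearly if $\|x^k-x_\star\|$ is bounded by a sequence converging Q-superlinearly to $0$. *)

(* Defs.v *)
From HB Require Import structures.
From mathcomp Require Import all_boot all_order all_algebra.
From mathcomp Require Import all_classical all_reals all_analysis.

Set Implicit Arguments.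
Unset Strict Implicit.
Unset Printing Implicit Defensive.
Import Order.TTheory GRing.Theory Num.Theory.
Import numFieldNormedType.Exports.
Local Open Scope classical_set_scope.
Local Open Scope ring_scope.

(* The library norm on 'cV[R]_n is the max norm: it is used here only through
   the topology it induces.  All metric quantities use [enorm] below. *)
Section Euclidean.
Context {R : realType}.

Definition dot n (u v : 'cV[R]_n) : R := (u^T *m v) 0 0.

Definition enorm n (u : 'cV[R]_n) : R := Num.sqrt (dot u u).

Definition opnorm m n (A : 'M[R]_(m, n)) : R :=
  sup [set enorm (A *m x) | x in [set x : 'cV[R]_n | enorm x <= 1]].

(* Column-vector counterpart of the library's [jacobian], which acts on row
   vectors from the right. *)
Definition cjacobian m n (F : 'cV[R]_n -> 'cV[R]_m) (p : 'cV[R]_n) :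
    'M[R]_(m, n) :=
  \matrix_(i < m, j < n) ('d F p (delta_mx j 0) : 'cV[R]_m) i 0.

Definition symmetric_psd n (H : 'M[R]_n) : Prop :=
  H^T = H /\ forall w : 'cV[R]_n, 0 <= dot (H *m w) w.

Definition mxrange m n (H : 'M[R]_(m, n)) : set 'cV[R]_m :=
  [set H *m u | u in [set: 'cV[R]_n]].

Definition mxker m n (H : 'M[R]_(m, n)) : set 'cV[R]_n :=
  [set w | H *m w = 0].

Definition orthogonal_compl n (S : {vspace 'cV[R]_n}) : set 'cV[R]_n :=
  [set w | forall s, s \in S -> dot s w = 0].

End Euclidean.

(* Functions R^n -> R \cup {+oo} are maps into \bar R; that -oo is not attained
   is part of [eproper]. *)
Section ConvexAnalysis.
Context {R : realType} {n : nat}.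
Implicit Types (h q : 'cV[R]_n -> \bar R) (x v w : 'cV[R]_n).
Local Open Scope ereal_scope.

Definition eproper h : Prop :=
  (forall x, -oo < h x) /\ exists x, h x < +oo.

(* By convention 0 * +oo = 0 in \bar R, so that t = 0 and t = 1 are harmless. *)
Definition econvex h : Prop := forall x y (t : R), (0 <= t <= 1)%R ->
  h (t *: x + (1 - t) *: y)%R <= t%:E * h x + (1 - t)%:E * h y.

Definition strongly_convex (mu : R) h : Prop :=
  econvex (fun x => h x - (mu / 2 * enorm x ^+ 2)%:E).

Definition fenchel h v : \bar R :=
  ereal_sup [set (dot v x)%:E - h x | x in [set: 'cV[R]_n]].

Definition subdiff h x : set 'cV[R]_n :=
  [set v | h x \is a fin_num /\
           forall x', h x + (dot v (x' - x))%:E <= h x'].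

Definition minimizers h : set 'cV[R]_n := [set x | forall x', h x <= h x'].

Definition argmin h : 'cV[R]_n := get (minimizers h).

Definition strong_minimizer h x : Prop :=
  exists2 a : R, (0 < a)%R &
    \forall x' \near x, (a * enorm (x' - x) ^+ 2)%:E <= h x' - h x.

Definition indicator (S : {vspace 'cV[R]_n}) w : \bar R :=
  if w \in S then 0 else +oo.

(* w |-> <H w, w> + delta_S(w) *)
Definition gen_quadratic (H : 'M[R]_n) (S : {vspace 'cV[R]_n}) w : \bar R :=
  (dot (H *m w) w)%:E + indicator S w.

End ConvexAnalysis.

(* Painleve-Kuratowski inner limit, outer limit and convergence of a family of
   sets C indexed along a filter F. *)
Section SetConvergence.
Context {I : Type} {T : topologicalType}.
Implicit Types (F : set_system I) (C : I -> set T).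

Definition pk_inner F C : set T :=
  [set p | forall U, nbhs p U -> F [set i | C i `&` U !=set0]].

Definition pk_outer F C : set T :=
  [set p | forall U, nbhs p U ->
           forall Q, F Q -> exists2 i, Q i & C i `&` U !=set0].

Definition pk_cvg F C (L : set T) : Prop :=
  pk_inner F C = L /\ pk_outer F C = L.

End SetConvergence.

Section EpiDifferentiability.
Context {R : realType} {n : nat}.
Implicit Types (h q : 'cV[R]_n -> \bar R) (x v d : 'cV[R]_n).
Local Open Scope ereal_scope.

Definition epigraph h : set ('cV[R]_n * R) := [set p | h p.1 <= p.2%:E].

Definition epi_cvg {I : Type} (F : set_system I)
    (hs : I -> 'cV[R]_n -> \bar R) q : Prop :=
  pk_cvg F (fun i => epigraph (hs i)) (epigraph q).

Definition quotient2 h x v (t : R) d : \bar R :=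
  (h (x + t *: d)%R - h x - (t * dot v d)%:E) / (t ^+ 2 / 2)%:E.

(* q is the second-order epi-derivative of h at x for v *)
Definition is_epi_derivative2 h x v q : Prop :=
  epi_cvg (0%R : R)^'+ (quotient2 h x v) q.

(* (t, (x', v')) -> (0, (x, v)) with t > 0 and v' a subgradient of h at x' *)
Definition strict_filter h x v : set_system (R * ('cV[R]_n * 'cV[R]_n)) :=
  within [set p | (0 < p.1)%R /\ subdiff h p.2.1 p.2.2]
         (nbhs ((0%R : R), (x, v))).

Definition strictly_twice_epi_diff_for h x v : Prop :=
  exists q, epi_cvg (strict_filter h x v)
                    (fun p => quotient2 h p.2.1 p.2.2 p.1) q.

Definition strictly_twice_epi_diff h x : Prop :=
  forall v, subdiff h x v -> strictly_twice_epi_diff_for h x v.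

End EpiDifferentiability.

Section Algorithm.
Context {R : realType} {n m : nat}.
Variables (f : 'cV[R]_n -> \bar R) (g : 'cV[R]_m -> \bar R).
Variables (A : 'M[R]_(m, n)).

Definition dual_function (y : 'cV[R]_m) : \bar R :=
  (fenchel f (- (A^T *m y))%R + fenchel g y)%E.

Definition aug_lagrangian (gamma : R) (x : 'cV[R]_n) (z y : 'cV[R]_m) : \bar R :=
  (f x + g z + (dot y (A *m x - z) + gamma / 2 * enorm (A *m x - z) ^+ 2)%:E)%E.

Definition xmin (y : 'cV[R]_m) : 'cV[R]_n :=
  argmin (fun x => f x + (dot y (A *m x))%:E)%E.

Definition zmin (gamma : R) (y : 'cV[R]_m) : 'cV[R]_m :=
  argmin (fun z => aug_lagrangian gamma (xmin y) z y).

Definition residual (gamma : R) (y : 'cV[R]_m) : 'cV[R]_m :=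
  zmin gamma y - A *m xmin y.

Definition trial (gamma : R) (x : 'cV[R]_n) (z y d : 'cV[R]_m) (t : R) :
    'cV[R]_m :=
  y + t *: d + (gamma * (1 - t)) *: (A *m x - z).

Record nama (gamma beta : R) (x : nat -> 'cV[R]_n) (z y d : nat -> 'cV[R]_m)
    (tau : nat -> R) : Prop := Nama {
  nama_x : forall k, x k = xmin (y k) ;
  nama_z : forall k, z k = zmin gamma (y k) ;
  nama_tau : forall k,
    let accepted (t : R) :=
      let yt := trial gamma (x k) (z k) (y k) (d k) t in
      (aug_lagrangian gamma (x k) (z k) (y k)
         <= aug_lagrangian gamma (xmin yt) (zmin gamma yt) yt)%E in
    exists i : nat, [/\ tau k = beta ^+ i, accepted (beta ^+ i) &
                        forall j, (j < i)%N -> ~ accepted (beta ^+ j)] ;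
  nama_y : forall k,
    let yt := trial gamma (x k) (z k) (y k) (d k) (tau k) in
    y k.+1 = yt + gamma *: (A *m xmin yt - zmin gamma yt)
}.

End Algorithm.

Section Rates.
Context {R : realType}.

(* The quotient is taken in \bar R, where c / 0 = +oo for c > 0 and 0 / 0 = 0.
   As +oo / +oo = 0 there as well, convergence to 0 is stated explicitly. *)
Definition q_superlinear (a : nat -> \bar R) : Prop :=
  a k @[k --> \oo] --> 0%E /\ (a k.+1 / a k)%E @[k --> \oo] --> 0%E.

Definition r_superlinear (a : nat -> R) : Prop :=
  exists2 b : nat -> R, (forall k, a k <= b k) & q_superlinear (EFin \o b).

End Rates.

(* Main.v *)
Require Import Defs.
From HB Require Import structures.
From mathcomp Require Import all_boot all_order all_algebra.
From mathcomp Require Import all_classical all_reals all_analysis.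
From mathcomp Require Import ring lra.
Set Implicit Arguments.
Unset Strict Implicit.
Unset Printing Implicit Defensive.
Import Order.TTheory GRing.Theory Num.Theory.
Import numFieldNormedType.Exports.
Local Open Scope classical_set_scope.
Local Open Scope ring_scope.

(* Write [x(y)], [z(y)] for the two minimizers and [rho y = z(y) - A x(y)].  The
   map [y |-> y - gamma * rho y] is the proximal gradient step on the dual
   function [psi], and minus the augmented Lagrangian at [(x(y), z(y), y)] is the
   forward-backward envelope of [psi].  The envelope is at most
   [psi ys + |y - ys|^2 / (2 gamma)] everywhere and exceeds [psi] at the stepped
   point by a multiple of [|rho y|^2], so it decreases along the iterates and
   [rho] tends to [0].  Quadratic growth of [psi] at [ys], compared with a
   subgradient of size [O(|rho y|)] at the stepped point, yields the error bound
   [|y - ys| = O(|rho y|)]: the iterates converge to [ys], and the Jacobian of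
   [rho] at [ys] is injective.  That Jacobian exists because [x(y)] and [z(y)]
   minimize strongly convex functions whose second-order quotients epi-converge
   to generalized quadratics, so that their difference quotients converge to the
   (linear) solution maps of the limit problems.  The Dennis-More condition then
   gives [|y k + d k - ys| = o(|y k - ys|)]; the two-sided quadratic bounds on
   the envelope turn this into acceptance of the unit step and into the rates. *)

(** * Euclidean norm *)

Section Euclid.
Context {R : realType}.

(** Bounded sequences converge along such an ultrafilter, so no subsequences need be extracted; the
    second clause says that [k] tends to infinity along it. *)
Lemma ultra_sequence : exists2 U : set_system nat, UltraFilter U &
  forall e : R, 0 < e -> U [set k | k.+1%:R^-1 < e].
Proof.
have [U [uU sU]] := ultraFilterLemma (@eventually_filter).
exists U => // e e0; apply: sU; near=> k.
rewrite /= -(invrK e) ltf_pV2 ?posrE ?invr_gt0 //.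
near: k; exists (Num.truncn e^-1) => // k /= ek.
by rewrite (lt_le_trans (truncnS_gt _)) // ler_nat ltnS.
Unshelve. all: by end_near. Qed.

Section Dot.
Context {n : nat}.
Implicit Types (u v w : 'cV[R]_n) (a : R).

Lemma dotE u v : dot u v = \sum_i u i 0 * v i 0.
Proof. by rewrite /dot mxE; apply: eq_bigr => i _; rewrite mxE. Qed.

Lemma dotC u v : dot u v = dot v u.
Proof. by rewrite !dotE; apply: eq_bigr => i _; rewrite mulrC. Qed.

Lemma dotDr u v w : dot u (v + w) = dot u v + dot u w.
Proof. by rewrite /dot mulmxDr mxE. Qed.

Lemma dotDl u v w : dot (u + v) w = dot u w + dot v w.
Proof. by rewrite dotC dotDr !(dotC w). Qed.

Lemma dotZr a u v : dot u (a *: v) = a * dot u v.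
Proof. by rewrite /dot -scalemxAr mxE. Qed.

Lemma dotZl a u v : dot (a *: u) v = a * dot u v.
Proof. by rewrite dotC dotZr dotC. Qed.

Lemma dotNr u v : dot u (- v) = - dot u v.
Proof. by rewrite -scaleN1r dotZr mulN1r. Qed.

Lemma dotNl u v : dot (- u) v = - dot u v.
Proof. by rewrite dotC dotNr dotC. Qed.

Lemma dot0r u : dot u 0 = 0.
Proof. by rewrite -[0](scale0r 0) dotZr mul0r. Qed.

Lemma dot0l u : dot 0 u = 0.
Proof. by rewrite dotC dot0r. Qed.

Definition dot_lin := (dotDl, dotDr, dotNl, dotNr, dotZl, dotZr, dot0l, dot0r).

Lemma dot_ge0 u : 0 <= dot u u.
Proof. by rewrite dotE sumr_ge0 // => i _; rewrite -expr2 sqr_ge0. Qed.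

Lemma dot_eq0 u : dot u u = 0 -> u = 0.
Proof.
rewrite dotE => /eqP; rewrite psumr_eq0 => [/allP u0|i _]; last first.
  by rewrite -expr2 sqr_ge0.
apply/matrixP => i j; rewrite (ord1 j) mxE; apply/eqP.
by have := u0 i (mem_index_enum i); rewrite -expr2 sqrf_eq0.
Qed.

Lemma enorm_ge0 u : 0 <= enorm u.
Proof. exact: sqrtr_ge0. Qed.

Lemma enorm_sqr u : enorm u ^+ 2 = dot u u.
Proof. by rewrite sqr_sqrtr // dot_ge0. Qed.

Lemma enorm0 : enorm (0 : 'cV[R]_n) = 0.
Proof. by rewrite /enorm dot0r sqrtr0. Qed.

Lemma enorm_eq0 u : (enorm u == 0) = (u == 0).
Proof.
apply/eqP/eqP => [u0|->]; last exact: enorm0.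
by apply: dot_eq0; rewrite -enorm_sqr u0 expr0n.
Qed.

Lemma enorm_gt0 u : (0 < enorm u) = (u != 0).
Proof. by rewrite lt_def enorm_eq0 enorm_ge0 andbT. Qed.

Lemma enormZ a u : enorm (a *: u) = `|a| * enorm u.
Proof.
by rewrite /enorm !dot_lin mulrA -expr2 sqrtrM ?sqr_ge0 // sqrtr_sqr.
Qed.

Lemma enormN u : enorm (- u) = enorm u.
Proof. by rewrite /enorm !dot_lin opprK. Qed.

Lemma enormB u v : enorm (u - v) = enorm (v - u).
Proof. by rewrite -enormN opprB. Qed.

Lemma dot_le u v : dot u v <= enorm u * enorm v.
Proof.
have [->|u0] := eqVneq u 0; first by rewrite dot0l enorm0 mul0r.
have [->|v0] := eqVneq v 0; first by rewrite dot0r enorm0 mulr0.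
have := dot_ge0 (enorm v *: u - enorm u *: v).
rewrite !dot_lin -!enorm_sqr (dotC v u).
have := enorm_gt0 u; have := enorm_gt0 v; rewrite u0 v0 => v_gt0 u_gt0.
have uv_gt0 : 0 < enorm u * enorm v by rewrite mulr_gt0.
move=> H; rewrite -(ler_pM2l uv_gt0); nra.
Qed.

Lemma ler_enormD u v : enorm (u + v) <= enorm u + enorm v.
Proof.
rewrite -(@ler_pXn2r _ 2) ?nnegrE ?addr_ge0 ?enorm_ge0 //.
rewrite enorm_sqr !dot_lin sqrrD !enorm_sqr (dotC v u).
have := dot_le u v; lra.
Qed.

Lemma ler_enormB u v : enorm (u - v) <= enorm u + enorm v.
Proof. by rewrite -(enormN v) ler_enormD. Qed.

Lemma ler_dist_enorm u v : enorm u - enorm v <= enorm (u - v).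
Proof. by rewrite lerBlDr -{1}(subrK v u) ler_enormD. Qed.

Lemma coord_le_enorm u i : `|u i 0| <= enorm u.
Proof.
rewrite -(@ler_pXn2r _ 2) ?nnegrE ?enorm_ge0 //.
rewrite enorm_sqr real_normK ?num_real // dotE (bigD1 i) //= -expr2 lerDl.
by rewrite sumr_ge0 // => j _; rewrite -expr2 sqr_ge0.
Qed.

Lemma enorm_le_coord u e : 0 <= e -> (forall i, `|u i 0| <= e) ->
  enorm u <= n%:R * e.
Proof.
move=> e0 ue; rewrite -(@ler_pXn2r _ 2) ?nnegrE ?mulr_ge0 ?enorm_ge0 //.
rewrite enorm_sqr dotE (@le_trans _ _ (\sum_(i < n) e ^+ 2)) //.
  apply: ler_sum => i _; rewrite -expr2 -real_normK ?num_real //.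
  by rewrite ler_pXn2r ?nnegrE.
rewrite sumr_const card_ord exprMn -[leLHS]mulr_natl ler_wpM2r ?sqr_ge0 //.
by rewrite -natrX ler_nat; case: (n) => // k; rewrite -mulnn leq_pmulr.
Qed.

Lemma nbhs_enormP (p : 'cV[R]_n) (V : set 'cV[R]_n) :
  nbhs p V <-> exists2 e, 0 < e & forall x, enorm (x - p) < e -> V x.
Proof.
split=> [/nbhs_ballP[e /= e0 eV]|[e e0 eV]].
  exists e => // x xe; apply: eV; split=> // i j; rewrite (ord1 j) /ball /=.
  by rewrite (le_lt_trans _ xe) // enormB; have := coord_le_enorm (p - x) i; rewrite !mxE.
(* The Euclidean norm is at most [n] times the max norm; [n.+1] gives a strict inequality and covers
   [n = 0]. *)
apply/nbhs_ballP; exists (e / n.+1%:R) => /=; first by rewrite divr_gt0.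
move=> x [_ px]; apply: eV.
have d0 : 0 <= e / n.+1%:R by rewrite divr_ge0 // ltW.
have := @enorm_le_coord (x - p) (e / n.+1%:R) d0.
rewrite mulrCA => H; apply: le_lt_trans (H _) _.
  by move=> i; rewrite ltW //; have := px i 0; rewrite /ball /= !mxE distrC.
by rewrite gtr_pMr // ltr_pdivrMr // mul1r ltr_nat.
Qed.

(** The image of [U] is again an ultrafilter, and it contains the compact segment from [- M] to
    [M]. *)
Lemma ultra_bounded_cvg (T : Type) (U : set_system T) (g : T -> R) (M : R) :
  UltraFilter U -> U [set t | `|g t| <= M] -> exists l : R, g @ U --> l.
Proof.
move=> uU gM.
have FU : UltraFilter (g @ U).
  split=> [|G pG sub]; first exact: fmap_proper_filter.
  apply/seteqP; split => [A GA|A]; last exact: sub.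
  have [//|nA] := in_ultra_setVsetC (g @^-1` A) uU.
  have /sub GnA : (g @ U) (~` A) by [].
  by case: (@filter_not_empty _ G pG); rewrite -(setICr A); exact: filterI.
have := @segment_compact R (- M) M; rewrite compact_ultra => /(_ _ FU).
have sM : (g @ U) `[- M, M]%classic.
  by apply: (@filterS _ U _ _ _ _ gM) => t gt; rewrite /= in_itv /= -ler_norml.
by move=> /(_ sM)[l [_ gl]]; exists l.
Qed.

Lemma ultra_bounded_enorm_cvg (T : Type) (U : set_system T)
    (g : T -> 'cV[R]_n) (M : R) :
  UltraFilter U -> U [set t | enorm (g t) <= M] ->
  exists l, forall e, 0 < e -> U [set t | enorm (g t - l) <= e].
Proof.
move=> uU gM.
have /choice[l gl] i : exists l : R, (fun t => g t i 0) @ U --> l.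
  apply: (@ultra_bounded_cvg _ _ _ M) => //.
  by apply: filterS gM => t; apply: le_trans; exact: coord_le_enorm.
exists (\col_i l i) => e e0.
have d0 : 0 < e / n.+1%:R by rewrite divr_gt0.
have : U [set t | forall i, `|g t i 0 - l i| <= e / n.+1%:R].
  apply: filter_forall => i.
  have /cvgrPdist_le/(_ _ d0) := gl i.
  by apply: filterS => t /=; rewrite distrC.
apply: filterS => t /= gt.
apply: le_trans (@enorm_le_coord _ (e / n.+1%:R) (ltW d0) _) _.
  by move=> i; rewrite !mxE.
by rewrite mulrCA ger_pMr // ler_pdivrMr // mul1r ler_nat.
Qed.

End Dot.

Lemma dot_mulmxr m n (A : 'M[R]_(m, n)) (u : 'cV[R]_m) (v : 'cV[R]_n) :
  dot u (A *m v) = dot (A^T *m u) v.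
Proof. by rewrite /dot trmx_mul trmxK mulmxA. Qed.

(** A crude entrywise constant suffices: it shows that the set whose supremum is [opnorm A] is
    bounded above. *)
Lemma enorm_mulmx_bounded m n (A : 'M[R]_(m, n)) :
  exists2 C, 0 <= C & forall v : 'cV[R]_n, enorm (A *m v) <= C * enorm v.
Proof.
have C0 : 0 <= \sum_i \sum_j `|A i j|.
  by rewrite sumr_ge0 // => i _; rewrite sumr_ge0.
exists (m%:R * \sum_i \sum_j `|A i j|) => [|v]; first by rewrite mulr_ge0.
rewrite -mulrA; apply: enorm_le_coord => [|i].
  by rewrite mulr_ge0 ?enorm_ge0.
rewrite mxE (le_trans (ler_norm_sum _ _ _)) //.
rewrite (bigD1 i) //= mulrDl ler_wpDr //.
  by rewrite mulr_ge0 ?enorm_ge0 // sumr_ge0 // => k _; rewrite sumr_ge0.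
rewrite mulr_suml; apply: ler_sum => j _; rewrite normrM ler_wpM2l //.
exact: coord_le_enorm.
Qed.

Lemma enorm_mulmx_le m n (A : 'M[R]_(m, n)) (v : 'cV[R]_n) :
  enorm (A *m v) <= opnorm A * enorm v.
Proof.
have [->|v0] := eqVneq v 0; first by rewrite mulmx0 !enorm0 mulr0.
have v_gt0 : 0 < enorm v by rewrite enorm_gt0.
rewrite -ler_pdivrMr //.
have -> : enorm (A *m v) / enorm v = enorm (A *m ((enorm v)^-1 *: v)).
  by rewrite -scalemxAr enormZ ger0_norm ?invr_ge0 ?enorm_ge0 // mulrC.
apply: ub_le_sup; last first.
  exists ((enorm v)^-1 *: v) => //=.
  by rewrite enormZ ger0_norm ?invr_ge0 ?enorm_ge0 // mulVf ?gt_eqF.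
have [C C0 AC] := enorm_mulmx_bounded A.
exists C => _ [u /= u1 <-]; rewrite (le_trans (AC u)) //.
by rewrite ler_piMr.
Qed.

Lemma opnorm_ge0 m n (A : 'M[R]_(m, n)) : 0 <= opnorm A.
Proof.
apply: (@le_trans _ _ (enorm (A *m 0))); first exact: enorm_ge0.
apply: ub_le_sup; last by exists 0 => //=; rewrite enorm0.
have [C C0 AC] := enorm_mulmx_bounded A.
exists C => _ [u /= u1 <-]; rewrite (le_trans (AC u)) //.
by rewrite ler_piMr.
Qed.

End Euclid.

(** * Strong convexity and tilted minimization *)

Section StrongConvexity.
Context {R : realType} {n : nat}.
Implicit Types (h : 'cV[R]_n -> \bar R) (x y p v w : 'cV[R]_n).

(* Convexity is handled through the epigraph, [h x <= r%:E], which avoids all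
   arithmetic with infinite values. *)
Definition sconv (c : R) h := forall x y (r s t : R), 0 <= t <= 1 ->
  (h x <= r%:E)%E -> (h y <= s%:E)%E ->
  (h (t *: x + (1 - t) *: y)%R <=
     (t * r + (1 - t) * s - c / 2 * (t * (1 - t)) * dot (x - y) (x - y))%:E)%E.

Lemma strongly_convex_sconv c h : strongly_convex c h -> sconv c h.
Proof.
move=> hc x y r s t t01 hx hy; have := hc x y t t01.
rewrite leeBlDr // => H; apply: (le_trans H).
have /andP[t0 t1] := t01.
apply: (@le_trans _ _ (t%:E * (r - c / 2 * enorm x ^+ 2)%:E +
  (1 - t)%:E * (s - c / 2 * enorm y ^+ 2)%:E +
  (c / 2 * enorm (t *: x + (1 - t) *: y)%R ^+ 2)%:E)%E).
  apply: leeD2r; apply: leeD; apply: lee_wpmul2l; rewrite ?lee_fin ?subr_ge0 //.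
    by rewrite EFinB leeD2r.
  by rewrite EFinB leeD2r.
rewrite -!EFinM -!EFinD lee_fin !enorm_sqr !dot_lin (dotC y x); lra.
Qed.

Lemma econvex_sconv h : econvex h -> sconv 0 h.
Proof.
move=> hc x y r s t t01 hx hy; apply: (le_trans (hc x y t t01)).
have /andP[t0 t1] := t01.
rewrite !mul0r subr0 [leRHS]EFinD !EFinM.
by apply: leeD; apply: lee_wpmul2l; rewrite ?lee_fin ?subr_ge0.
Qed.

Lemma sconvD c1 c2 h (q : 'cV[R]_n -> R) :
  sconv c1 h ->
  (forall x y (t : R), q (t *: x + (1 - t) *: y) =
     t * q x + (1 - t) * q y - c2 / 2 * (t * (1 - t)) * dot (x - y) (x - y)) ->
  sconv (c1 + c2) (fun x => h x + (q x)%:E)%E.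
Proof.
move=> hc qE x y r s t t01.
rewrite -!leeBrDr // -!EFinB => hx hy.
by apply: le_trans (hc _ _ _ _ t t01 hx hy) _; rewrite lee_fin qE; lra.
Qed.

Lemma lower_semicontinuousDr h (q : 'cV[R]_n -> R) :
  lower_semicontinuous h -> continuous q ->
  lower_semicontinuous (fun x => h x + (q x)%:E)%E.
Proof.
move=> hl qc x a; rewrite -lteBlDr // -EFinB => ah.
have [b ab bh] : exists2 b, a - q x < b & (b%:E < h x)%E.
  case hx : (h x) ah => [r| |] //; last first.
    by move=> _; exists (a - q x + 1); rewrite ?ltry ?ltrDl.
  rewrite lte_fin => ar; exists ((a - q x + r) / 2); rewrite ?lte_fin; lra.
have [V Vx Vb] := hl _ _ bh.
have /cvgrPdist_lt/(_ (q x + b - a)) := qc x.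
have e0 : 0 < q x + b - a by lra.
move=> /(_ e0) Wx.
exists (V `&` [set y | `|q x - q y| < q x + b - a]); first exact: filterI.
move=> y [/Vb by_ /=]; rewrite ltr_norml => /andP[_ H].
by rewrite -lteBlDr // -EFinB (le_lt_trans _ by_) // lee_fin; lra.
Qed.

(** Lower semicontinuity bounds [h] below on a small ball around [x0]. A far point is pulled into
    that ball along a segment, and the strong convexity term, quadratic in the distance, dominates
    the linear loss. *)
Lemma sconv_bounded_below c h : 0 < c -> eproper h ->
  lower_semicontinuous h -> sconv c h ->
  exists b, forall x r, (h x <= r%:E)%E -> b <= r.
Proof.
move=> c0 [hN [x0 hx0]] hl hc.
have [a ha] : exists a, h x0 = a%:E.
  by exists (fine (h x0)); rewrite fineK // fin_real // hN hx0.
have [|V /nbhs_enormP[d d0 dV] Va] := hl x0 (a - 1).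
  by rewrite ha lte_fin ltrBlDr ltrDl.
(* The last term is the maximum over [D] of [2 * D / d - c / 4 * D ^+ 2]. *)
exists (a - 1 - 2 * (2 / (c * d ^+ 2))) => x r hx.
have k0 : 0 < 2 / (c * d ^+ 2) by rewrite divr_gt0 // mulr_gt0 // exprn_gt0.
have [xd|dx] := ltP (enorm (x - x0)) d.
  have /Va/lt_le_trans/(_ hx) := dV _ xd; rewrite lte_fin; lra.
pose D := enorm (x - x0).
have D0 : 0 < D by apply: lt_le_trans dx.
pose t := d / (2 * D).
have tD : t * D = d / 2 by rewrite /t; field; rewrite gt_eqF.
have t0 : 0 < t by rewrite /t divr_gt0 // mulr_gt0.
have t1 : t <= 1 / 2 by rewrite -(ler_pM2r D0) tD; rewrite /D; lra.
have t01 : 0 <= t <= 1 by apply/andP; split; lra.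
have h0 : (h x0 <= a%:E)%E by rewrite ha.
have := hc x x0 r a t t01 hx h0.
have pd : enorm (t *: x + (1 - t) *: x0 - x0) < d.
  have -> : t *: x + (1 - t) *: x0 - x0 = t *: (x - x0).
    by apply/matrixP => i j; rewrite !mxE; ring.
  by rewrite enormZ ger0_norm ?(ltW t0) // -/D tD; lra.
have /Va/lt_le_trans H := dV _ pd.
move=> /H; rewrite lte_fin -enorm_sqr -/D => {}H.
(* divide by t and complete the square in D = |x - x0| *)
have H1 : a - 1 / t + c / 2 * (1 - t) * D ^+ 2 < r.
  rewrite -(ltr_pM2l t0).
  have -> : t * (a - 1 / t + c / 2 * (1 - t) * D ^+ 2) =
    t * a - 1 + c / 2 * (t * (1 - t)) * D ^+ 2 by field; rewrite gt_eqF.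
  lra.
have tE : 1 / t = 2 * D / d by rewrite /t; field; rewrite !gt_eqF.
rewrite tE in H1.
have H2 : c / 4 * D ^+ 2 <= c / 2 * (1 - t) * D ^+ 2.
  by rewrite ler_wpM2r ?sqr_ge0 //; nra.
have H3 : 2 * D / d <= c / 4 * D ^+ 2 + 2 * (2 / (c * d ^+ 2)).
  rewrite -subr_ge0.
  have -> : c / 4 * D ^+ 2 + 2 * (2 / (c * d ^+ 2)) - 2 * D / d =
    c / 4 * (D - 4 / (c * d)) ^+ 2 by field; rewrite !gt_eqF.
  by rewrite mulr_ge0 ?sqr_ge0 // divr_ge0 // ltW.
lra.
Qed.

End StrongConvexity.

Section TiltedMinimization.
Context {R : realType} {n : nat}.
Implicit Types (h : 'cV[R]_n -> \bar R) (x y p v w : 'cV[R]_n).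

(** Strong convexity at midpoints bounds a minimizing sequence; its limit along an ultrafilter is a
    minimizer by lower semicontinuity. The growth comes from strong convexity on the segment from
    [p] to [x]. *)
Lemma sconv_min c h : 0 < c -> eproper h -> lower_semicontinuous h ->
  sconv c h -> exists p a, h p = a%:E /\
    forall x r, (h x <= r%:E)%E -> a + c / 2 * dot (x - p) (x - p) <= r.
Proof.
move=> c0 hp hl hc; have [b hb] := sconv_bounded_below c0 hp hl hc.
have [hN [x0 hx0]] := hp.
pose S := [set r : R | exists x, (h x <= r%:E)%E].
have Sinf : has_inf S.
  split; last by exists b => r [x /hb].
  by exists (fine (h x0)), x0; rewrite fineK // fin_real // hN hx0.
pose a := inf S.
have aS x r : (h x <= r%:E)%E -> a <= r.
  by move=> hx; apply: ge_inf; [case: Sinf | exists x].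
have /choice[u hu] (k : nat) : exists x, (h x <= (a + k.+1%:R^-1)%:E)%E.
  have k0 : 0 < k.+1%:R^-1 :> R by rewrite invr_gt0.
  have [r [x hx] /ltW ra] := inf_adherent k0 Sinf.
  by exists x; rewrite (le_trans hx) // lee_fin.
have [U uU Usmall] := @ultra_sequence R.
have u1 k : (h (u k) <= (a + 1)%:E)%E.
  by apply: le_trans (hu k) _; rewrite lee_fin lerD2l invf_le1 // ler1n.
have bd k : enorm (u k - u 0%N) <= 8 / c + 1.
  have H12 : 0 <= (1 / 2 : R) <= 1 by apply/andP; split; lra.
  have /aS := hc _ _ _ _ _ H12 (u1 k) (u1 0%N).
  rewrite -enorm_sqr; have := enorm_ge0 (u k - u 0%N).
  set D := enorm _ => D0 H.
  have {}H : D ^+ 2 <= 8 / c by rewrite ler_pdivlMr //; lra.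
  nra.
have [|l ul] := @ultra_bounded_enorm_cvg _ _ _ U (fun k => u k - u 0%N) (8 / c + 1) uU.
  by apply: filterS filterT => k _ /=.
pose p := u 0%N + l.
have hpa : (h p <= a%:E)%E.
  rewrite leNgt; apply/negP => ap.
  have [e e0 eh] : exists2 e, 0 < e & ((a + e)%:E < h p)%E.
    case hpE : (h p) ap => [r| |] //; last by exists 1; rewrite ?ltry.
    by rewrite lte_fin => ar; exists ((r - a) / 2); rewrite ?lte_fin; lra.
  have [V /nbhs_enormP[d d0 dV] Vb] := hl _ _ eh.
  have Ud : U [set k | enorm (u k - u 0%N - l) <= d / 2] by apply: ul; lra.
  have Ue := Usmall e e0.
  have [k [/= dk ek]] := filter_ex (filterI Ud Ue).
  have /Vb : V (u k).
    by apply: dV; rewrite /p opprD addrA; lra.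
  rewrite ltNge => /negP; apply; apply: le_trans (hu k) _.
  by rewrite lee_fin lerD2l ltW.
have [a' pa] : exists a', h p = a'%:E.
  by exists (fine (h p)); rewrite fineK // fin_real // hN (le_lt_trans hpa) ?ltry.
exists p, a; split=> [|x r hx].
  rewrite pa; congr _%:E; apply/le_anti; rewrite -lee_fin -pa hpa /=.
  by apply: (aS p); rewrite pa.
rewrite leNgt; apply/negP => rlt.
have := dot_ge0 (x - p); set D := dot _ _ => D0.
pose D' := c / 2 * D; have D'0 : 0 <= D' by rewrite mulr_ge0 // divr_ge0 // ltW.
pose e := a + D' - r; have e0 : 0 < e by rewrite subr_gt0.
(* If growth fails by [e], moving from [p] towards [x] by this fraction brings the value below the
   infimum, because [t * D' < e]. *)
pose t := e / (2 * (e + D')).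
have tE : t * (e + D') = e / 2 by rewrite /t; field; rewrite gt_eqF //; lra.
have t0 : 0 < t by rewrite divr_gt0 // mulr_gt0 //; lra.
have t1 : t <= 1 / 2 by rewrite -(@ler_pM2r _ (e + D')) ?tE //; lra.
have t01 : 0 <= t <= 1 by apply/andP; split; lra.
have /aS := hc _ _ _ _ _ t01 hx hpa; rewrite -/D.
have -> : t * r + (1 - t) * a - c / 2 * (t * (1 - t)) * D =
   a - t * (e - t * D') by rewrite /e /D'; ring.
have te : 0 < t * e by rewrite mulr_gt0.
have : t * (t * (e + D')) = t * (e / 2) by rewrite tE.
have : 0 < t * (t * e) by rewrite mulr_gt0.
lra.
Qed.

(* [p] minimizes [h + c/2 |.|^2 - <v, .>], with value [a = h p], and this
   function grows quadratically with modulus [s] around [p]. *)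
Definition tilted_min h (c s : R) v p (a : R) := h p = a%:E /\
  forall x r, (h x <= r%:E)%E ->
    a + c / 2 * dot p p - dot v p + s / 2 * dot (x - p) (x - p) <=
    r + c / 2 * dot x x - dot v x.

Lemma continuous_dotl v : continuous (fun x => dot v x).
Proof.
move=> x; rewrite (_ : (fun x => _) = fun x => \sum_i v i 0 * x i 0); last first.
  by apply/funext => y; rewrite dotE.
apply: cvg_big; [exact: add_continuous | exact: nbhs_filter |].
by move=> i _; apply: cvgMl_tmp;
  [exact: (nbhs_filter x) | exact: (@coord_continuous R n 1 i 0 x)].
Qed.

Lemma continuous_dot_self : continuous (fun x => dot x x).
Proof.
move=> x; rewrite (_ : (fun x => _) = fun x => \sum_i x i 0 * x i 0); last first.
  by apply/funext => y; rewrite dotE.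
apply: cvg_big; [exact: add_continuous | exact: nbhs_filter |].
by move=> i _; apply: cvgM;
  [exact: (nbhs_filter x) | exact: (@coord_continuous R n 1 i 0 x) ..].
Qed.

(** Applied with [c = 0] to [f], and with [s = 0] to [g], where the quadratic of the augmented
    Lagrangian supplies the modulus. *)
Lemma tilted_min_exists (s c : R) h v : 0 < s + c -> eproper h ->
  lower_semicontinuous h -> sconv s h ->
  exists p a, tilted_min h c (s + c) v p a.
Proof.
move=> sc0 [hN [x0 hx0]] hl hs.
pose q x := c / 2 * dot x x - dot v x.
have qE x y (t : R) : q (t *: x + (1 - t) *: y) =
     t * q x + (1 - t) * q y - c / 2 * (t * (1 - t)) * dot (x - y) (x - y).
  by rewrite /q !dot_lin (dotC y x); ring.
have qc : continuous q.
  move=> x.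
  exact: (cvgB (cvgMl_tmp (@continuous_dot_self x)) (@continuous_dotl v x)).
have kp : eproper (fun x => h x + (q x)%:E)%E.
  split=> [x|]; last by exists x0; rewrite lte_add_pinfty ?ltry.
  by rewrite -[ltLHS](addNye (q x)%:E) // lteD2rE.
have [p [a [pa H]]] := sconv_min sc0 kp (lower_semicontinuousDr hl qc) (sconvD hs qE).
exists p, (a - q p); split.
  by rewrite EFinB -pa addeK.
move=> x r hx.
have /H : (h x + (q x)%:E <= (r + q x)%:E)%E by rewrite EFinD leeD2r.
rewrite /q !dot_lin; lra.
Qed.

(** [argmin] merely picks some minimizer; quadratic growth makes it unique. The constant [b] absorbs
    terms independent of the variable. *)
Lemma tilted_min_argmin h c s v p a k (b : R) : 0 < s ->
  (forall x, -oo < h x)%E -> tilted_min h c s v p a ->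
  (forall x, k x = h x + (c / 2 * dot x x - dot v x + b)%:E)%E ->
  argmin k = p.
Proof.
move=> s0 hN [hp H] kE; rewrite /argmin.
have mp : minimizers k p.
  move=> x; rewrite !kE hp; case hx : (h x) (hN x) => [r| |] hNx; last first.
  - by rewrite ltxx in hNx.
  - by rewrite leey.
  have := H x r; rewrite hx lexx => /(_ isT).
  have := dot_ge0 (x - p) => D0 H1.
  have : 0 <= s / 2 * dot (x - p) (x - p) by rewrite mulr_ge0 // divr_ge0 // ltW.
  by rewrite -!EFinD lee_fin; lra.
have : minimizers k (get (minimizers k)) by apply: getI mp.
set x := get _ => /(_ p); rewrite !kE hp.
case hx : (h x) (hN x) => [r| |] hNx; [|by [] | by rewrite ltxx in hNx].
have := H x r; rewrite hx lexx => /(_ isT).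
rewrite -!EFinD lee_fin => H1 H2.
have D0 := dot_ge0 (x - p).
apply/eqP; rewrite -subr_eq0; apply/eqP/dot_eq0/le_anti; rewrite D0 andbT.
have : s / 2 * dot (x - p) (x - p) <= 0 by lra.
by rewrite pmulr_rle0 // divr_gt0.
Qed.

(** Each growth inequality is tested at the other minimizer, and the two are added. *)
Lemma tilted_min_monotone h c s v p a v' p' a' :
  tilted_min h c s v p a -> tilted_min h c s v' p' a' ->
  s * dot (p' - p) (p' - p) <= dot (v' - v) (p' - p).
Proof.
move=> [hp H] [hp' H'].
have := H p' a'; rewrite hp' lexx => /(_ isT).
have := H' p a; rewrite hp lexx => /(_ isT).
rewrite !dot_lin (dotC p p'); lra.
Qed.

Lemma tilted_min_lipschitz h c s v p a v' p' a' : 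
  tilted_min h c s v p a -> tilted_min h c s v' p' a' ->
  s * enorm (p' - p) <= enorm (v' - v).
Proof.
move=> H /(tilted_min_monotone H); rewrite -enorm_sqr => H1.
have [->|d0] := eqVneq (p' - p) 0; first by rewrite enorm0 mulr0 enorm_ge0.
have d_gt0 : 0 < enorm (p' - p) by rewrite enorm_gt0.
rewrite -(ler_pM2r d_gt0) -mulrA -expr2 (le_trans H1) //; exact: dot_le.
Qed.

Lemma tilted_min_unique h c s v p a p' a' : 0 < s ->
  tilted_min h c s v p a -> tilted_min h c s v p' a' -> p = p'.
Proof.
move=> s0 hp /(tilted_min_lipschitz hp); rewrite subrr enorm0 pmulr_rle0 // => H.
apply/eqP; rewrite eq_sym -subr_eq0 -enorm_eq0.
by apply/eqP/le_anti; rewrite H enorm_ge0.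
Qed.

End TiltedMinimization.

(** * Second-order expansion of minimizers *)

Section PositiveOnSubspace.
Context {R : realType} {n : nat}.
Implicit Types (S : {vspace 'cV[R]_n}).

(* In a basis [E] of [S], the solution is [E K^-1 E^T w] with [K = E^T H E]. *)
Lemma orthogonal_solution S (H : 'M[R]_n) :
  (forall u : 'cV[R]_n, u \in S -> u != 0 -> 0 < dot (H *m u) u) ->
  exists D : 'M[R]_n, forall w : 'cV[R]_n, (D *m w) \in S /\
    forall s, s \in S -> dot (H *m (D *m w) - w) s = 0.
Proof.
move=> Hpos; pose k := \dim S.
pose E : 'M[R]_(n, k) := \matrix_(i, j) ((vbasis S)`_j : 'cV[R]_n) i 0.
have EE (c : 'cV[R]_k) : E *m c = \sum_j c j 0 *: (vbasis S)`_j.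
  apply/matrixP => i j; rewrite (ord1 j) mxE summxE.
  by apply: eq_bigr => l _; rewrite !mxE mulrC.
have ES (c : 'cV[R]_k) : E *m c \in S.
  rewrite EE; apply: memv_suml => i _; apply: memvZ.
  by apply: vbasis_mem; rewrite mem_nth // size_tuple.
have E0 (c : 'cV[R]_k) : E *m c = 0 -> c = 0.
  rewrite EE => /(freeP (basis_free (vbasisP S)) (fun j => c j 0)) c0.
  by apply/matrixP => i j; rewrite (ord1 j) c0 mxE.
pose K := E^T *m H *m E.
have uK : K \in unitmx.
  rewrite -unitmx_tr -row_free_unit; apply: inj_row_free => v vK.
  have Kv : K *m v^T = 0 by rewrite -(trmxK K) -trmx_mul vK trmx0.
  apply: (can_inj trmxK); rewrite trmx0; apply: E0; apply/eqP/negPn/negP => Ev0.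
  have := Hpos _ (ES _) Ev0.
  by rewrite dot_mulmxr !mulmxA -/K Kv dot0l ltxx.
exists (E *m invmx K *m E^T) => w; split; first by rewrite -!mulmxA ES.
move=> s sS.
have -> : s = E *m \col_j coord (vbasis S) j s.
  rewrite EE {1}(coord_vbasis sS); apply: eq_bigr => j _; by rewrite mxE.
rewrite dot_mulmxr mulmxBr !mulmxA -/K mulmxV // mul1mx subrr dot0l //.
Qed.

End PositiveOnSubspace.

Section Differentiability.
Context {R : realType}.

(** Frechet differentiability in the Euclidean norm, with the derivative given as a matrix. *)
Definition ediff n m (F : 'cV[R]_n -> 'cV[R]_m) p (D : 'M[R]_(m, n)) :=
  forall e, 0 < e -> exists2 d, 0 < d & forall h, enorm h < d ->
    enorm (F (p + h) - F p - D *m h) <= e * enorm h.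

Section TiltedMinDiff.
Context {n : nat}.
Implicit Types (h : 'cV[R]_n -> \bar R) (x y p u v w : 'cV[R]_n).

Lemma quotient2_le h x v (t a : R) y r : 0 < t -> h x = a%:E ->
  (quotient2 h x v t y <= r%:E)%E =
  (h (x + t *: y)%R <= (a + t * dot v y + t ^+ 2 / 2 * r)%:E)%E.
Proof.
move=> t0 hx; have t2 : 0 < t ^+ 2 / 2 by rewrite divr_gt0 // exprn_gt0.
rewrite /quotient2 hx inver gt_eqF // lee_pdivrMr // -EFinM.
rewrite !leeBlDr // -!EFinD; congr (_ <= _%:E)%E; ring.
Qed.

Lemma at_right0P (Q : set R) :
  (0 : R)^'+ Q <-> exists2 d, 0 < d & forall t, 0 < t -> t < d -> Q t.
Proof.
split=> [/nbhs_ballP[d /= d0 dQ]|[d d0 dQ]].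
  exists d => // t t0 td; apply: dQ => //=.
  by rewrite /ball /= sub0r normrN gtr0_norm.
apply/nbhs_ballP; exists d => // t /= td t0; apply: dQ => //.
by move: td; rewrite /ball /= sub0r normrN gtr0_norm.
Qed.

(** The constant depends only on [c] and the base point [(w, z)], so that inequalities between tilts
    [c |z|^2 - 2 <w, z>] pass to the limit. *)
Lemma tilt_close (c eta : R) (w w' z z' : 'cV[R]_n) :
  0 <= c -> eta <= 1 -> enorm (w' - w) <= eta -> enorm (z' - z) <= eta ->
  `|(c * dot z' z' - 2 * dot w' z') - (c * dot z z - 2 * dot w z)| <=
  (c * (2 * enorm z + 1) + 2 * enorm w + 2 * (enorm z + 1)) * eta.
Proof.
move=> c0 e1 we ze; have e0 : 0 <= eta by apply: le_trans (enorm_ge0 _) we.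
have dle (a b : 'cV[R]_n) : `|dot a b| <= enorm a * enorm b.
  by rewrite ler_norml dot_le andbT lerNl -dotNl -(enormN a) dot_le.
have -> : (c * dot z' z' - 2 * dot w' z') - (c * dot z z - 2 * dot w z) =
  c * dot (z' - z) (z' + z) - 2 * dot w (z' - z) - 2 * dot (w' - w) z'.
  by rewrite !dot_lin (dotC z z'); ring.
have z'z : enorm z' <= enorm z + 1.
  by have := ler_dist_enorm z' z; lra.
have z'Dz : enorm (z' + z) <= 2 * enorm z + 1.
  by have := ler_enormD z' z; lra.
have H1 : `|dot (z' - z) (z' + z)| <= eta * (2 * enorm z + 1).
  by apply: le_trans (dle _ _) _; apply: ler_pM; rewrite ?enorm_ge0.
have H2 : `|dot w (z' - z)| <= enorm w * eta.
  by apply: le_trans (dle _ _) _; apply: ler_pM; rewrite ?enorm_ge0.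
have H3 : `|dot (w' - w) z'| <= eta * (enorm z + 1).
  by apply: le_trans (dle _ _) _; apply: ler_pM; rewrite ?enorm_ge0.
have H1' := ler_wpM2l c0 H1.
apply: le_trans (ler_normB _ _) _.
rewrite [X in _ + X <= _]normrM.
have := ler_normB (c * dot (z' - z) (z' + z)) (2 * dot w (z' - z)).
rewrite !normrM (ger0_norm c0) (ger0_norm (ler0n _ 2)); lra.
Qed.

Lemma le_of_linear_error (a b C : R) : 0 <= C ->
  (forall e, 0 < e -> e <= 1 -> a <= b + C * e) -> a <= b.
Proof.
move=> C0 H; apply/ler_addgt0Pr => e e0.
have C1 : 0 < C + 1 by lra.
have m0 : 0 < Num.min 1 (e / (C + 1)) by rewrite lt_min ltr01 divr_gt0.
apply: le_trans (H _ m0 _) _; first by rewrite ge_min lexx.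
rewrite lerD2l; apply: (@le_trans _ _ (C * (e / (C + 1)))).
  by rewrite ler_wpM2l // ge_min lexx orbT.
rewrite mulrCA ger_pMr // ler_pdivrMr // mul1r; lra.
Qed.

Lemma gen_quadratic_le (H : 'M[R]_n) (S : {vspace 'cV[R]_n}) w r :
  (gen_quadratic H S w <= r%:E)%E = (w \in S) && (dot (H *m w) w <= r).
Proof.
rewrite /gen_quadratic /indicator; case: ifPn => wS /=.
  by rewrite adde0 lee_fin.
by rewrite addeC addye.
Qed.

(** Minimality of [p'], divided by [t ^+ 2 / 2]: the difference quotient [z] minimizes the
    second-order quotient of [h] plus the tilt [c |z|^2 - 2 <w, z>]. *)
Lemma tilted_quotient_le h (c s : R) v w p p' a a' (t : R) z z' r r' :
  0 <= s -> 0 < t -> tilted_min h c s (v + t *: w) p' a' ->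
  p' = p + t *: z ->
  a' = a + t * dot (v - c *: p) z + t ^+ 2 / 2 * r ->
  (h (p + t *: z')%R <= (a + t * dot (v - c *: p) z' + t ^+ 2 / 2 * r')%:E)%E ->
  r + (c * dot z z - 2 * dot w z) <= r' + (c * dot z' z' - 2 * dot w z').
Proof.
move=> s0 t0 [_ H] pE aE /H {H}; rewrite pE aE.
have t2 : 0 < t ^+ 2 / 2 by rewrite divr_gt0 // exprn_gt0.
set D := dot (_ - _) (_ - _).
have D0 : 0 <= s / 2 * D by rewrite mulr_ge0 ?dot_ge0 // divr_ge0.
move: D0; set sD := s / 2 * D => D0.
rewrite !dot_lin (dotC z p) (dotC z' p) => H.
rewrite -(ler_pM2l t2).
move: H; rewrite !expr2; lra.
Qed.

(** The bound [c <= s] makes [v0 - c *: X v0] a subgradient of [h] at [X v0], so the second-order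
    values are nonnegative. The derivative is the solution map of [orthogonal_solution] for
    [H + c%:M]. *)
Lemma tilted_min_ediff h (c s : R) (X : 'cV[R]_n -> 'cV[R]_n)
    (a : 'cV[R]_n -> R) v0 (H : 'M[R]_n) (S : {vspace 'cV[R]_n}) :
  0 < s -> 0 <= c <= s -> (forall v, tilted_min h c s v (X v) (a v)) ->
  H^T = H ->
  (forall u, u \in S -> u != 0 -> 0 < dot ((H + c%:M) *m u) u) ->
  is_epi_derivative2 h (X v0) (v0 - c *: X v0) (gen_quadratic H S) ->
  exists D : 'M[R]_n, ediff X v0 D.
Proof.
move=> s0 /andP[c0 cs] hX HT Kpos [inner outer].
have [D HD] := orthogonal_solution Kpos; exists D => e e0.
(* If the expansion fails along increments [g k] -> 0, the rescaled increments
   [w k], difference quotients [z k] and second-order values [r k] are bounded,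
   hence converge along an ultrafilter.  The outer epi-limit makes the limit of
   [z k] feasible, a recovery sequence from the inner one makes it optimal for
   the limit problem, so that it equals [D *m lim w]. *)
apply: contrapT => nd.
have bad (k : nat) : exists h : 'cV[R]_n, enorm h < k.+1%:R^-1 /\
    e * enorm h < enorm (X (v0 + h) - X v0 - D *m h).
  apply: contrapT => nb; apply: nd; exists k.+1%:R^-1.
    by rewrite invr_gt0.
  move=> h' h'k; rewrite leNgt; apply/negP => h'e; apply: nb.
  by exists h'.
have {nd bad}[g hg] := choice bad.
have [U uU Usmall] := @ultra_sequence R.
have UT (P : set nat) : (forall k, P k) -> U P.
  by move=> hP; apply: filterS filterT => k _.
pose t k := enorm (g k).
have t0 k : 0 < t k.
  rewrite enorm_gt0; apply/negP => /eqP gk; have := (hg k).2.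
  by rewrite gk addr0 subrr mulmx0 subrr enorm0 mulr0 ltxx.
have [w wdef] : exists w : nat -> 'cV[R]_n, forall k, w k = (t k)^-1 *: g k.
  by exists (fun k => (t k)^-1 *: g k).
have gE k : g k = t k *: w k by rewrite wdef scalerA mulfV ?scale1r ?gt_eqF.
have w1 k : enorm (w k) = 1.
  by rewrite wdef enormZ gtr0_norm ?invr_gt0 // mulVf ?gt_eqF.
have [z zdef] : exists z : nat -> 'cV[R]_n,
    forall k, z k = (t k)^-1 *: (X (v0 + g k) - X v0).
  by exists (fun k => (t k)^-1 *: (X (v0 + g k) - X v0)).
have zE k : X (v0 + g k) = X v0 + t k *: z k.
  by rewrite zdef scalerA mulfV ?gt_eqF // scale1r [RHS]addrC subrK.
have zs k : enorm (z k) <= s^-1.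
  rewrite zdef enormZ gtr0_norm ?invr_gt0 // ler_pdivrMl //.
  rewrite ler_pdivlMr // mulrC (le_trans (tilted_min_lipschitz (hX v0) (hX _))) //.
  by rewrite addrC addKr.
pose u := v0 - c *: X v0.
pose r k := (a (v0 + g k) - a v0 - t k * dot u (z k)) / (t k ^+ 2 / 2).
have t2 k : 0 < t k ^+ 2 / 2 by rewrite divr_gt0 // exprn_gt0.
have rE k : a (v0 + g k) = a v0 + t k * dot u (z k) + t k ^+ 2 / 2 * r k.
  by rewrite /r mulrCA mulfV ?gt_eqF // mulr1; ring.
have hq k z' r' :
    (quotient2 h (X v0) u (t k) z' <= r'%:E)%E ->
    r k + (c * dot (z k) (z k) - 2 * dot (w k) (z k)) <=
    r' + (c * dot z' z' - 2 * dot (w k) z').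
  rewrite (quotient2_le _ _ _ _ (hX v0).1) //.
  have := hX (v0 + g k); rewrite {1}gE => hXk.
  exact: tilted_quotient_le (ltW s0) (t0 k) hXk (zE k) (rE k).
have qk k : (quotient2 h (X v0) u (t k) (z k) <= (r k)%:E)%E.
  by rewrite (quotient2_le _ _ _ _ (hX v0).1) // -zE -rE (hX _).1.
have zz k : dot (z k) (z k) <= s^-1 * s^-1.
  by rewrite -enorm_sqr expr2 ler_pM ?enorm_ge0.
have r_ge0 k : 0 <= r k.
  have := (hX v0).2 (X (v0 + g k)) (a (v0 + g k)).
  rewrite (hX _).1 lexx => /(_ isT).
  rewrite zE (_ : X v0 + t k *: z k - X v0 = t k *: z k); last first.
    by rewrite addrC addKr.
  rewrite rE /u !dot_lin (dotC (z k) (X v0)).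
  have : 0 <= (s - c) / 2 * (t k * (t k * dot (z k) (z k))).
    rewrite mulr_ge0 ?divr_ge0 ?subr_ge0 // mulr_ge0 ?(ltW (t0 k)) //.
    by rewrite mulr_ge0 ?(ltW (t0 k)) // dot_ge0.
  move=> A B; rewrite -(pmulr_rge0 _ (t2 k)); lra.
have r_le k : r k <= 2 * s^-1.
  (* Comparison with the zero increment, whose second-order value is [0]. *)
  have /hq : (quotient2 h (X v0) u (t k) 0 <= 0%:E)%E.
    rewrite (quotient2_le _ _ _ _ (hX v0).1) // scaler0 addr0 (hX _).1 lee_fin.
    by rewrite dot0r !mulr0 !addr0.
  rewrite !dot0r; have := dot_le (w k) (z k); rewrite w1 mul1r.
  have := zs k; have : 0 <= c * dot (z k) (z k) by rewrite mulr_ge0 ?dot_ge0.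
  lra.
have [|wb Hw] := @ultra_bounded_enorm_cvg R n _ U w 1 uU.
  by apply: UT => k /=; rewrite w1.
have [|zb Hz] := @ultra_bounded_enorm_cvg R n _ U z s^-1 uU.
  exact: UT.
have [|rb Hr] := @ultra_bounded_cvg R _ U r (2 * s^-1) uU.
  by apply: UT => k /=; rewrite ger0_norm.
have {}Hr d : 0 < d -> U [set k | `|rb - r k| < d].
  by move=> d0; have /cvgrPdist_lt/(_ _ d0) := Hr.
have Ut (Q : set R) : (0 : R)^'+ Q -> U [set k | Q (t k)].
  move=> /at_right0P[d d0 dQ]; apply: filterS (Usmall d d0) => k /= kd.
  by apply: dQ => //; apply: lt_trans kd; exact: (hg k).1.
have : epigraph (gen_quadratic H S) (zb, rb).
  rewrite -outer => V /nbhs_ballP[d /= d0 dV] Q /Ut UQ.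
  have [d' d'0 d'V] : exists2 d', 0 < d' & forall x, enorm (x - zb) < d' ->
      ball zb d x.
    by apply/nbhs_enormP; exact: nbhsx_ballx.
  have d'2 : 0 < d' / 2 by rewrite divr_gt0.
  have := filter_ex (filterI UQ (filterI (Hz _ d'2) (Hr _ d0))).
  move=> [k /= [Qk [zk rk]]]; exists (t k) => //.
  exists (z k, r k); split; first exact: qk.
  by apply: dV; split => //=; apply: d'V; lra.
rewrite /epigraph /= gen_quadratic_le => /andP[zbS qzb].
have [DwS Dwo] := HD wb.
pose zs' := D *m wb; pose q' := dot (H *m zs') zs'.
have : epigraph (gen_quadratic H S) (zs', q').
  by rewrite /epigraph /= gen_quadratic_le DwS lexx.
rewrite -inner => recov.
pose C1 := c * (2 * enorm zb + 1) + 2 * enorm wb + 2 * (enorm zb + 1).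
pose C2 := c * (2 * enorm zs' + 1) + 2 * enorm wb + 2 * (enorm zs' + 1).
have C1_ge0 : 0 <= C1.
  by rewrite /= !addr_ge0 ?mulr_ge0 ?addr_ge0 ?mulr_ge0 ?enorm_ge0.
have C2_ge0 : 0 <= C2.
  by rewrite /= !addr_ge0 ?mulr_ge0 ?addr_ge0 ?mulr_ge0 ?enorm_ge0.
have opt : rb + (c * dot zb zb - 2 * dot wb zb) <=
    q' + (c * dot zs' zs' - 2 * dot wb zs').
  apply: (@le_of_linear_error _ _ (C1 + C2 + 2)) => [|d d0 d1].
    exact: addr_ge0 (addr_ge0 C1_ge0 C2_ge0) (ler0n _ 2).
  have /Ut UQ : (0 : R)^'+ [set t | epigraph (quotient2 h (X v0) u t) `&`
      [set x | enorm (x.1 - zs') < d /\ `|x.2 - q'| < d] !=set0].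
    apply: recov; exists ([set x | enorm (x - zs') < d], [set x | `|x - q'| < d]).
      split=> /=; first by apply/nbhs_enormP; exists d.
      by apply/nbhs_ballP; exists d => //= x; rewrite /ball /= distrC.
    by move=> [x1 x2] [].
  have := filter_ex (filterI UQ (filterI (Hz _ d0) (filterI (Hr _ d0) (Hw _ d0)))).
  move=> [k /= [[[z' r'] [/= qk' [z'd r'd]]] [zk [rk wk]]]].
  have := hq k z' r' qk'.
  have := tilt_close c0 d1 wk zk.
  have := tilt_close c0 d1 wk (ltW z'd).
  rewrite -/C1 -/C2 !ler_norml => /andP[_ A2] /andP[A1 _].
  by move: rk r'd; rewrite !ltr_norml => /andP[_ B1] /andP[_ B2]; lra.
(* [zs'] is stationary along [S] for the limit problem, so the excess of [zb] over it is the form of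
   [H + c%:M] at [zb - zs'], positive unless the two coincide. *)
have zbE : zb = zs'.
  apply/eqP; rewrite -subr_eq0; apply/negPn/negP => nz.
  have dS : zb - zs' \in S by rewrite memvB.
  have := Kpos _ dS nz; have := Dwo _ dS.
  rewrite -/zs' !mulmxDl !mul_scalar_mx !mulmxBr !dot_lin.
  have HC (x y : 'cV[R]_n) : dot (H *m x) y = dot (H *m y) x.
    by rewrite dotC dot_mulmxr HT.
  rewrite (HC zb zs') (dotC zb zs').
  move: opt qzb; rewrite /q'; lra.
have [CD CD0 HCD] := enorm_mulmx_bounded D.
(* With this tolerance [|z k - D *m w k|] is at most [e / 2], against the choice of [g k]. *)
have d0 : 0 < e / (2 * (1 + CD)) by rewrite divr_gt0 // mulr_gt0 //; lra.
have [k /= [zk wk]] := filter_ex (filterI (Hz _ d0) (Hw _ d0)).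
have := (hg k).2; rewrite zE [X in enorm (X - _)]addrAC subrr add0r {2}gE.
rewrite -scalemxAr -scalerBr enormZ (gtr0_norm (t0 k)) mulrC (ltr_pM2l (t0 k)).
apply/negP; rewrite -leNgt.
have -> : z k - D *m w k = (z k - zb) - D *m (w k - wb).
  by rewrite mulmxBr -/zs' -zbE opprB addrA subrK.
apply: le_trans (ler_enormB _ _) _.
have := HCD (w k - wb) => B1.
have B2 : CD * enorm (w k - wb) <= CD * (e / (2 * (1 + CD))) by rewrite ler_wpM2l.
have B3 : (1 + CD) * (e / (2 * (1 + CD))) = e / 2 by field; lra.
lra.
Qed.

End TiltedMinDiff.
End Differentiability.

(** * Jacobians, conjugates and rates *)

Section Jacobian.
Context {R : realType}.

Lemma mx_norm_le_enorm n (u : 'cV[R]_n) : `|u| <= enorm u.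
Proof.
rewrite /Num.norm /= mx_normrE; apply/bigmax_leP; split; first exact: enorm_ge0.
by move=> [i j] _ /=; rewrite (ord1 j); exact: coord_le_enorm.
Qed.

Lemma enorm_le_mx_norm n (u : 'cV[R]_n) : enorm u <= n%:R * `|u|.
Proof.
apply: enorm_le_coord => // i.
rewrite [leRHS]/Num.norm /= mx_normrE.
by apply: (@le_bigmax _ _ _ 0 (fun p : 'I_n * 'I_1 => `|u p.1 p.2|) (i, 0)).
Qed.

(** ['d F p] is defined by choice and is identified through uniqueness of the differential; the
    dimension factor converts the Euclidean norm to the library norm. *)
Lemma ediff_cjacobian n m (F : 'cV[R]_n -> 'cV[R]_m) p (D : 'M[R]_(m, n)) :
  ediff F p D -> cjacobian F p = D.
Proof.
move=> FD.
have Dc : continuous (mulmx D : 'cV[R]_n -> 'cV[R]_m).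
  have [C C0 DC] := enorm_mulmx_bounded D.
  move=> x V /nbhs_enormP[e e0 eV]; apply/nbhs_enormP.
  exists (e / (C + 1)) => [|y]; first by rewrite divr_gt0 //; lra.
  rewrite ltr_pdivlMr; last by lra.
  move=> yx; apply: eV; rewrite -mulmxBr (le_lt_trans (DC _)) //.
  by have := enorm_ge0 (y - x); lra.
have dF : 'd F p = mulmx D :> ('cV[R]_n -> 'cV[R]_m).
  apply: diff_unique => //; apply/eqaddoP => e e0.
  have d0 : 0 < e / n.+1%:R by rewrite divr_gt0.
  have [d d1 dF] := FD _ d0.
  apply/nbhs_enormP; exists d => // h; rewrite subr0 => /dF H.
  rewrite /= !fctE; apply: le_trans (mx_norm_le_enorm _) _.
  rewrite opprD addrA [h + p]addrC (le_trans H) //.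
  rewrite mulrAC ler_pdivrMr // -mulrA ler_pM2l // (le_trans (enorm_le_mx_norm h)) //.
  by rewrite mulrC ler_wpM2l // ler_nat.
apply/matrixP => i j; rewrite mxE dF.
rewrite mxE (bigD1 j) //= mxE !eqxx mulr1 big1 ?addr0 // => k kj.
by rewrite mxE (negbTE kj) mulr0.
Qed.

End Jacobian.

Section Fenchel.
Context {R : realType} {n : nat}.

Lemma fenchel_leP (h : 'cV[R]_n -> \bar R) v a :
  (forall x, -oo < h x)%E ->
  (fenchel h v <= a%:E)%E <-> forall x r, (h x <= r%:E)%E -> dot v x - r <= a.
Proof.
move=> hN; split=> [H x r hx|H].
  rewrite -lee_fin EFinB; apply: le_trans _ H.
  apply: (@le_trans _ _ ((dot v x)%:E - h x)%E); first by rewrite leeD2l ?leeN2.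
  by apply: ereal_sup_ubound; exists x.
apply: ge_ereal_sup => _ [x _ <-].
case hx : (h x) (hN x) => [r| |] hNx; last by rewrite ltxx in hNx.
  by rewrite -EFinB lee_fin H // hx.
by rewrite addeNy leNye.
Qed.

Lemma fenchel_ge (h : 'cV[R]_n -> \bar R) v x r :
  (h x <= r%:E)%E -> ((dot v x - r)%:E <= fenchel h v)%E.
Proof.
move=> hx; apply: (@le_trans _ _ ((dot v x)%:E - h x)%E).
  by rewrite EFinB leeD2l ?leeN2.
by apply: ereal_sup_ubound; exists x.
Qed.

(** Equality case of the Fenchel-Young inequality: the last hypothesis makes [v] a subgradient at
    [x]. *)
Lemma fenchel_eq (h : 'cV[R]_n -> \bar R) v x a :
  (forall x, -oo < h x)%E -> h x = a%:E ->
  (forall x' r, (h x' <= r%:E)%E -> a + dot v (x' - x) <= r) ->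
  fenchel h v = (dot v x - a)%:E.
Proof.
move=> hN hx H; apply/le_anti/andP; split.
  apply/fenchel_leP => // x' r /H; rewrite !dot_lin; lra.
by apply: fenchel_ge; rewrite hx.
Qed.

End Fenchel.

Section Rates.
Context {R : realType}.

Lemma near_shiftS (P : nat -> Prop) :
  (\forall k \near \oo, P k) -> \forall k \near \oo, P k.+1.
Proof. by move=> [N _ H]; exists N => // k /= Nk; apply: H; exact: leqW. Qed.

(** Passing to an eventually positive real sequence keeps the conventions for division in [\bar R]
    out of the limit. *)
Lemma q_superlinear_near (u : nat -> \bar R) (v : nat -> R) :
  (\forall k \near \oo, u k = (v k)%:E) -> (\forall k \near \oo, 0 < v k) ->
  v k @[k --> \oo] --> 0 ->
  (forall e, 0 < e -> \forall k \near \oo, v k.+1 <= e * v k) ->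
  q_superlinear u.
Proof.
move=> uv v_gt0 v0 vS; split.
  apply: (@cvg_trans _ ((v k)%:E @[k --> \oo])).
    by apply: near_eq_cvg; near=> k; symmetry; near: k.
  by apply: cvg_EFin => //; exact: nearW.
apply: (@cvg_trans _ ((v k.+1 / v k)%:E @[k --> \oo])).
  apply: near_eq_cvg; near=> k.
  have -> : u k = (v k)%:E by near: k.
  have -> : u k.+1 = (v k.+1)%:E by near: k; exact: (near_shiftS uv).
  have vk : 0 < v k by near: k.
  by rewrite inver gt_eqF // EFinM.
apply: cvg_EFin; first exact: nearW.
apply/cvgrPdist_le => e e0; near=> k.
have vk : 0 < v k by near: k.
have vk1 : 0 < v k.+1 by near: k; exact: (near_shiftS v_gt0).
rewrite sub0r normrN ger0_norm; last by rewrite divr_ge0 ?(ltW vk) ?(ltW vk1).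
rewrite ler_pdivrMr //.
by near: k; exact: vS.
Unshelve. all: by end_near. Qed.

End Rates.

(** * The forward-backward envelope of the dual *)

Lemma subrBB (V : zmodType) (a b c d : V) : a - b - (c - d) = a - c - (b - d).
Proof. by rewrite !opprB addrACA [RHS]addrACA [- b - c]addrC. Qed.

(** Remainder of the chain rule for the residual: [D] is the derivative of [x(y)], [E] that of the
    minimizer in [z] with respect to its tilt, and [xi] the increment of [x(y)]. *)
Lemma linearization_error (R : realType) n m (A : 'M[R]_(m, n)) (gamma : R)
    (E : 'M[R]_m) (D : 'M[R]_(n, m)) (h : 'cV[R]_m) (xi : 'cV[R]_n) err :
  E *m (h + gamma *: (A *m xi)) + err - A *m xi -
    (E *m (1%:M + gamma *: (A *m D)) - A *m D) *m h =
  E *m (gamma *: (A *m (xi - D *m h))) + err - A *m (xi - D *m h).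
Proof.
rewrite mulmxBl -(mulmxA E) mulmxDl mul1mx -scalemxAl -(mulmxA A D h).
rewrite (mulmxBr A xi) scalerBr !mulmxDr (mulmxN E).
move: (E *m h) (E *m (gamma *: (A *m xi))) => a1 a2.
move: (E *m (gamma *: (A *m (D *m h)))) (A *m xi) (A *m (D *m h)) => a3 a4 a5.
by apply/matrixP => i j; rewrite !mxE; ring.
Qed.

Section ForwardBackward.
Context {R : realType} {n m : nat}.
Context (A : 'M[R]_(m, n)) (f : 'cV[R]_n -> \bar R) (g : 'cV[R]_m -> \bar R).
Context (mu gamma : R).
Context (f_proper : eproper f) (f_closed : lower_semicontinuous f).
Context (mu_gt0 : 0 < mu) (f_strong : strongly_convex mu f).
Context (g_proper : eproper g) (g_closed : lower_semicontinuous g).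
Context (g_convex : econvex g).
Context (gamma_gt0 : 0 < gamma) (gamma_small : gamma * opnorm A ^+ 2 < mu).

Local Notation X := (xmin f A).
Local Notation Z := (zmin f g A gamma).
Local Notation rho := (residual f g A gamma).
Local Notation psi := (dual_function f g A).

Definition fxmin y : R := fine (f (X y)).
Definition gzmin y : R := fine (g (Z y)).

(* The smooth part [f^*(- A^T y)] of the dual function. *)
Definition dual_smooth y : R := - (fxmin y + dot y (A *m X y)).

(* By Moreau's decomposition this is the proximal gradient step
   [prox_(gamma g^* )(y + gamma A x(y))] on the dual function. *)
Definition fb_step y := y - gamma *: rho y.

Definition fb_envelope y : R :=
  dual_smooth y + dot y (Z y) - gzmin y - gamma / 2 * dot (rho y) (rho y).

(** The value of [psi] at [fb_step y]: [Z y] attains the supremum defining the conjugate of [g]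
    there. *)
Definition dual_step y : R :=
  dual_smooth (fb_step y) + dot (fb_step y) (Z y) - gzmin y.

Lemma xmin_tilted y : tilted_min f 0 mu (- (A^T *m y)) (X y) (fxmin y).
Proof.
have mu0 : 0 < mu + 0 by rewrite addr0.
have [p [a]] := tilted_min_exists (- (A^T *m y)) mu0 f_proper f_closed
  (strongly_convex_sconv f_strong).
rewrite addr0 => pa; have Xp : X y = p.
  apply: (tilted_min_argmin (b := 0) mu_gt0 _ pa) => [|x]; first by case: f_proper.
  by rewrite !mul0r sub0r addr0 !dot_lin opprK dot_mulmxr.
by rewrite /fxmin Xp pa.1.
Qed.

(** Up to a constant, the augmented Lagrangian in [z] is [g z + gamma / 2 |z|^2 - <y + gamma A x(y),
    z>]. *)
Lemma zmin_tilted y :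
  tilted_min g gamma gamma (y + gamma *: (A *m X y)) (Z y) (gzmin y).
Proof.
have ga0 : 0 < 0 + gamma by rewrite add0r.
have [p [a]] := tilted_min_exists (y + gamma *: (A *m X y)) ga0 g_proper
  g_closed (econvex_sconv g_convex).
rewrite add0r => pa; have Zp : Z y = p.
  apply: (tilted_min_argmin (b := fxmin y + dot y (A *m X y) +
    gamma / 2 * dot (A *m X y) (A *m X y)) gamma_gt0 _ pa) => [|z].
    by case: g_proper.
  rewrite /aug_lagrangian (xmin_tilted y).1 [X in (X + _)%E]addeC -addeA -EFinD.
  congr (_ + _%:E)%E; rewrite enorm_sqr !dot_lin (dotC z (A *m X y)); lra.
by rewrite /gzmin Zp pa.1.
Qed.

Lemma aug_lagrangian_envelope y :
  aug_lagrangian f g A gamma (X y) (Z y) y = (- fb_envelope y)%:E.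
Proof.
rewrite /aug_lagrangian (xmin_tilted y).1 (zmin_tilted y).1 -!EFinD.
congr _%:E; rewrite /fb_envelope /dual_smooth /residual enorm_sqr.
rewrite !dot_lin; ring.
Qed.

Lemma fxmin_le y x r : (f x <= r%:E)%E ->
  fxmin y + dot y (A *m X y) + mu / 2 * dot (x - X y) (x - X y) <=
  r + dot y (A *m x).
Proof.
move=> /((xmin_tilted y).2); rewrite !mul0r !addr0 !dot_mulmxr !dotNl; lra.
Qed.

(** [- A x(y)] is a subgradient of the smooth part at [y]: the minimum defining [dual_smooth w] is
    tested at [X y]. *)
Lemma dual_smooth_ge y w :
  dual_smooth y - dot (w - y) (A *m X y) <= dual_smooth w.
Proof.
have := @fxmin_le w (X y) (fxmin y); rewrite (xmin_tilted y).1 lexx => /(_ isT).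
have : 0 <= mu / 2 * dot (X y - X w) (X y - X w).
  by rewrite mulr_ge0 ?dot_ge0 // divr_ge0 // ltW.
rewrite /dual_smooth !(dotDl w) !dotNl; lra.
Qed.

Lemma xmin_lipschitz y w : mu * enorm (X w - X y) <= opnorm A * enorm (w - y).
Proof.
have := tilted_min_monotone (xmin_tilted y) (xmin_tilted w).
have -> : dot (- (A^T *m w) - - (A^T *m y)) (X w - X y) =
    dot (- (w - y)) (A *m (X w - X y)).
  by rewrite dot_mulmxr mulmxN mulmxBr opprB opprK addrC.
move=> H.
have {H} : mu * enorm (X w - X y) ^+ 2 <=
    (opnorm A * enorm (w - y)) * enorm (X w - X y).
  rewrite enorm_sqr (le_trans H) // (le_trans (dot_le _ _)) // enormN.
  by rewrite mulrAC [leRHS]mulrC ler_wpM2l ?enorm_ge0 // enorm_mulmx_le.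
have [->|x0] := eqVneq (X w - X y) 0.
  by move=> _; rewrite enorm0 mulr0 mulr_ge0 ?opnorm_ge0 ?enorm_ge0.
by rewrite expr2 mulrA ler_pM2r // enorm_gt0.
Qed.

(** The step size bound makes [gamma A x(y)] nonexpansive in [y]. *)
Lemma gamma_Axmin_lipschitz y w :
  gamma * enorm (A *m (X w - X y)) <= enorm (w - y).
Proof.
rewrite -(ler_pM2l mu_gt0).
have H1 := enorm_mulmx_le A (X w - X y).
have H2 := xmin_lipschitz y w.
have o0 := opnorm_ge0 A.
apply: (@le_trans _ _ (gamma * opnorm A ^+ 2 * enorm (w - y))); last first.
  by rewrite ler_wpM2r ?enorm_ge0 // ltW.
have H3 : mu * enorm (A *m (X w - X y)) <= opnorm A * (opnorm A * enorm (w - y)).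
  apply: (@le_trans _ _ (opnorm A * (mu * enorm (X w - X y)))).
    by rewrite mulrCA ler_pM2l.
  by rewrite ler_wpM2l.
by rewrite mulrCA -mulrA ler_pM2l // expr2 -mulrA.
Qed.

(** Descent lemma for a gradient with Lipschitz constant [|A|^2 / mu], multiplied by [mu] to avoid
    division. *)
Lemma dual_smooth_le y w :
  mu * dual_smooth w <= mu * (dual_smooth y - dot (w - y) (A *m X y)) +
    opnorm A ^+ 2 / 2 * dot (w - y) (w - y).
Proof.
have := @fxmin_le y (X w) (fxmin w); rewrite (xmin_tilted w).1 lexx => /(_ isT).
set D := dot (_ - _) (_ - _) => H.
have H1 : - dot (w - y) (A *m (X w - X y)) <=
    enorm (w - y) * (opnorm A * enorm (X w - X y)).
  rewrite -dotNl (le_trans (dot_le _ _)) // enormN.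
  by rewrite ler_wpM2l ?enorm_ge0 // enorm_mulmx_le.
have H2 : dual_smooth w <= dual_smooth y - mu / 2 * D
    - dot (w - y) (A *m X y) - dot (w - y) (A *m (X w - X y)).
  rewrite mulmxBr !dot_lin /dual_smooth; lra.
move: H1 H2; rewrite /D -!enorm_sqr.
set e := enorm (X w - X y); set d := enorm (w - y); set o := opnorm A.
move=> H1 H2; have : 0 <= (mu * e - o * d) ^+ 2 by rewrite sqr_ge0.
have := ler_wpM2l (ltW mu_gt0) H2; have := ler_wpM2l (ltW mu_gt0) H1.
lra.
Qed.

(** Optimality condition for [Z y]: the quadratic terms cancel because the growth modulus equals
    [gamma], leaving [fb_step y] as a subgradient of [g] at [Z y]. *)
Lemma fb_step_subgradient y z r : (g z <= r%:E)%E ->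
  gzmin y + dot (fb_step y) (z - Z y) <= r.
Proof.
move=> /((zmin_tilted y).2); rewrite /fb_step /residual !dot_lin.
rewrite (dotC z (Z y)); lra.
Qed.

Lemma dual_functionE w : psi w = ((dual_smooth w)%:E + fenchel g w)%E.
Proof.
rewrite /dual_function; congr (_ + _)%E.
rewrite (@fenchel_eq _ _ f _ (X w) (fxmin w)); first 2 last.
- exact: (xmin_tilted w).1.
- move=> x r /(fxmin_le w); rewrite !dot_lin !dot_mulmxr.
  have : 0 <= mu / 2 * dot (x - X w) (x - X w).
    by rewrite mulr_ge0 ?dot_ge0 // divr_ge0 // ltW.
  rewrite !dot_lin; lra.
- by congr _%:E; rewrite /dual_smooth dot_mulmxr dotNl opprD addrC.
- by case: f_proper.
Qed.

Lemma dual_function_leP w r : (psi w <= r%:E)%E <->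
  forall z s, (g z <= s%:E)%E -> dual_smooth w + dot w z - s <= r.
Proof.
rewrite dual_functionE -leeBrDl // -EFinB.
rewrite fenchel_leP; last by case: g_proper.
by split=> H z s /H; lra.
Qed.

Lemma dual_function_ge w z s : (g z <= s%:E)%E ->
  ((dual_smooth w + dot w z - s)%:E <= psi w)%E.
Proof.
by move=> gz; rewrite dual_functionE -addrA EFinD leeD2l // fenchel_ge.
Qed.

Lemma dual_function_fb_step y : psi (fb_step y) = (dual_step y)%:E.
Proof.
rewrite dual_functionE (@fenchel_eq _ _ g _ (Z y) (gzmin y)) //.
- by rewrite -EFinD addrA.
- by case: g_proper.
- exact: (zmin_tilted y).1.
- by move=> z r; exact: fb_step_subgradient.
Qed.

(** [psi] is a supremum over [z]; for fixed [z] only the smooth part matters, and it is handled by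
    its subgradient at the intermediate point. *)
Lemma dual_function_convex w w' r r' t : 0 <= t <= 1 ->
  (psi w <= r%:E)%E -> (psi w' <= r'%:E)%E ->
  (psi (t *: w + (1 - t) *: w')%R <= (t * r + (1 - t) * r')%:E)%E.
Proof.
move=> /andP[t0 t1] /dual_function_leP H /dual_function_leP H'.
apply/dual_function_leP => z s gz.
have t1' : 0 <= 1 - t by rewrite subr_ge0.
have := ler_wpM2l t0 (H _ _ gz); have := ler_wpM2l t1' (H' _ _ gz).
set v := t *: w + _.
have := ler_wpM2l t0 (dual_smooth_ge v w).
have := ler_wpM2l t1' (dual_smooth_ge v w').
rewrite /v !dot_lin; set xv := A *m _; lra.
Qed.

(** The descent lemma between [y] and [fb_step y]. *)
Lemma dual_step_descent y :
  dual_step y + (gamma / 2) * (1 - gamma * opnorm A ^+ 2 / mu) *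
    dot (rho y) (rho y) <= fb_envelope y.
Proof.
have := dual_smooth_le y (fb_step y).
rewrite /dual_step /fb_envelope.
have -> : fb_step y - y = - (gamma *: rho y) by rewrite /fb_step addrAC subrr add0r.
have AX : A *m X y = Z y - rho y by rewrite /residual opprB addrC subrK.
have -> : dot (fb_step y) (Z y) = dot y (Z y) - gamma * dot (rho y) (Z y).
  by rewrite dotDl dotNl dotZl.
rewrite AX; move: (dual_smooth (fb_step y)) (rho y) => f2 rr.
rewrite !dot_lin opprK => H; rewrite -(ler_pM2l mu_gt0).
have mE : mu * (gamma * opnorm A ^+ 2 / mu) = gamma * opnorm A ^+ 2.
  by field; rewrite gt_eqF.
move: (gamma * _ / mu) mE => q mE.
have := congr1 (fun u => u * (gamma / 2 * dot rr rr)) mE.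
move: H; rewrite (dotC rr (Z y)); lra.
Qed.

(** The smooth part is minorized by its tangent at [y], the conjugate of [g] by the affine function
    coming from [Z y]; then the square of [rho y + (w - y) / gamma] is completed. *)
Lemma fb_envelope_le y w :
  ((fb_envelope y - 1 / (2 * gamma) * dot (w - y) (w - y))%:E <= psi w)%E.
Proof.
have gz : (g (Z y) <= (gzmin y)%:E)%E by rewrite (zmin_tilted y).1.
apply: le_trans _ (dual_function_ge w gz); rewrite lee_fin.
have := dual_smooth_ge y w.
have AX : A *m X y = Z y - rho y by rewrite /residual opprB addrC subrK.
rewrite AX /fb_envelope; move: (rho y) (Z y) (gzmin y) => rr zz gz'.
have -> : dot w zz = dot y zz + dot (w - y) zz by rewrite -dotDl addrC subrK.
move: (w - y) => ww; rewrite dotDr dotNr.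
have : 0 <= gamma / 2 * dot (rr + gamma^-1 *: ww) (rr + gamma^-1 *: ww).
  by rewrite mulr_ge0 ?dot_ge0 // divr_ge0 // ltW.
have -> : gamma / 2 * dot (rr + gamma^-1 *: ww) (rr + gamma^-1 *: ww) =
  gamma / 2 * dot rr rr + dot ww rr + 1 / (2 * gamma) * dot ww ww.
  by rewrite !dot_lin (dotC rr ww); field; rewrite gt_eqF.
lra.
Qed.

(** A subgradient of [psi] at [fb_step y]: [Z y] is one for the conjugate of [g], and
    [- A x(fb_step y)] is the gradient of the smooth part. *)
Definition fb_step_grad y := Z y - A *m X (fb_step y).

Lemma dual_step_subgradient y w :
  ((dual_step y + dot (w - fb_step y) (fb_step_grad y))%:E <= psi w)%E.
Proof.
have gz : (g (Z y) <= (gzmin y)%:E)%E by rewrite (zmin_tilted y).1.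
apply: le_trans _ (dual_function_ge w gz); rewrite lee_fin.
have := dual_smooth_ge (fb_step y) w.
rewrite /dual_step /fb_step_grad dotDr dotNr; set p := fb_step y.
rewrite (dotDl w (- p) (Z y)) dotNl; lra.
Qed.

Lemma fb_step_grad_le y : enorm (fb_step_grad y) <= 2 * enorm (rho y).
Proof.
have -> : fb_step_grad y = rho y - A *m (X (fb_step y) - X y).
  by rewrite /fb_step_grad /residual mulmxBr opprB addrA subrK.
have := ler_enormB (rho y) (A *m (X (fb_step y) - X y)).
have := gamma_Axmin_lipschitz y (fb_step y).
have -> : fb_step y - y = - (gamma *: rho y) by rewrite /fb_step addrAC subrr add0r.
rewrite enormN enormZ gtr0_norm // ler_pM2l //; lra.
Qed.

Lemma residual_lipschitz y w :
  gamma * enorm (rho w - rho y) <= 3 * enorm (w - y).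
Proof.
have := tilted_min_lipschitz (zmin_tilted y) (zmin_tilted w).
have -> : w + gamma *: (A *m X w) - (y + gamma *: (A *m X y)) =
   (w - y) + gamma *: (A *m (X w - X y)).
  by rewrite mulmxBr scalerBr opprD addrACA.
have := ler_enormD (w - y) (gamma *: (A *m (X w - X y))).
have := gamma_Axmin_lipschitz y w; rewrite enormZ gtr0_norm //.
have -> : rho w - rho y = (Z w - Z y) - A *m (X w - X y).
  by rewrite /residual mulmxBr [LHS]subrBB.
have := ler_enormB (Z w - Z y) (A *m (X w - X y)).
rewrite -(ler_pM2l gamma_gt0); lra.
Qed.

Lemma fb_step_lipschitz y w :
  enorm (fb_step w - fb_step y) <= 4 * enorm (w - y).
Proof.
have -> : fb_step w - fb_step y = (w - y) - gamma *: (rho w - rho y).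
  by rewrite /fb_step (scalerBr _ (rho w)) [LHS]subrBB.
have := ler_enormB (w - y) (gamma *: (rho w - rho y)).
rewrite enormZ gtr0_norm //; have := residual_lipschitz y w; lra.
Qed.

(** * Differentiability of the residual at the dual solution *)

Section ResidualDiff.
Context (ys : 'cV[R]_m).
Context (Hf : 'M[R]_n) (Sf : {vspace 'cV[R]_n}) (Hg : 'M[R]_m)
  (Sg : {vspace 'cV[R]_m}).
Context (Hf_sym : Hf^T = Hf)
  (Hf_pos : forall u, u \in Sf -> u != 0 -> 0 < dot (Hf *m u) u).
Context (f_epi2 : is_epi_derivative2 f (X ys) (- (A^T *m ys)) (gen_quadratic Hf Sf)).
Context (Hg_psd : symmetric_psd Hg).
Context (g_epi2 : is_epi_derivative2 g (Z ys) (fb_step ys) (gen_quadratic Hg Sg)).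

Lemma xmin_ediff : exists D : 'M[R]_(n, m), ediff X ys D.
Proof.
(* [tilted_min_ediff] asks for a minimizer at every tilt, not only at those of the form
   [- A^T y]. *)
have tf v : exists pa : 'cV[R]_n * R, tilted_min f 0 mu v pa.1 pa.2.
  have mu0 : 0 < mu + 0 by rewrite addr0.
  have [p [a]] := tilted_min_exists v mu0 f_proper f_closed
    (strongly_convex_sconv f_strong).
  by rewrite addr0 => pa; exists (p, a).
have {tf}[F hF] := choice tf.
have XE y : X y = (F (- (A^T *m y))).1.
  exact: tilted_min_unique mu_gt0 (xmin_tilted y) (hF _).
have := @tilted_min_ediff R n f 0 mu _ _ (- (A^T *m ys)) Hf Sf mu_gt0 _ hF Hf_sym.
rewrite lexx (ltW mu_gt0) => /(_ isT); rewrite -XE scale0r subr0.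
have Hpos u : u \in Sf -> u != 0 -> 0 < dot ((Hf + 0%:M) *m u) u.
  by rewrite mulmxDl mul_scalar_mx scale0r addr0; exact: Hf_pos.
move=> /(_ Hpos f_epi2)[D HD].
exists (- (D *m A^T)) => e e0.
have [C C0 AC] := enorm_mulmx_bounded A^T.
have C1 : 0 < C + 1 by lra.
have [d d0 Hd] := HD (e / (C + 1)) (divr_gt0 e0 C1).
exists (d / (C + 1)) => [|h]; first by rewrite divr_gt0.
rewrite ltr_pdivlMr // => hd.
have Ah : enorm (- (A^T *m h)) <= enorm h * (C + 1).
  by rewrite enormN; have := AC h; have := enorm_ge0 h; lra.
have := Hd _ (le_lt_trans Ah hd).
rewrite -opprD -mulmxDr -!XE mulmxN opprK mulNmx opprK -mulmxA => H.
apply: (le_trans H); apply: (@le_trans _ _ (e / (C + 1) * (enorm h * (C + 1)))).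
  by rewrite ler_wpM2l // divr_ge0 // ltW.
by rewrite mulrCA divfK ?gt_eqF // mulrC.
Qed.

Lemma residual_ediff : exists J : 'M[R]_m, ediff rho ys J.
Proof.
have [D HD] := xmin_ediff.
have tg v : exists pa : 'cV[R]_m * R, tilted_min g gamma gamma v pa.1 pa.2.
  have ga0 : 0 < 0 + gamma by rewrite add0r.
  have [p [a]] := tilted_min_exists v ga0 g_proper g_closed (econvex_sconv g_convex).
  by rewrite add0r => pa; exists (p, a).
have {tg}[G hG] := choice tg.
have ZE y : Z y = (G (y + gamma *: (A *m X y))).1.
  exact: tilted_min_unique gamma_gt0 (zmin_tilted y) (hG _).
pose v0 := ys + gamma *: (A *m X ys).
have := @tilted_min_ediff R m g gamma gamma _ _ v0 Hg Sg gamma_gt0 _ hG Hg_psd.1.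
rewrite lexx (ltW gamma_gt0) -ZE => /(_ isT).
have -> : v0 - gamma *: Z ys = fb_step ys.
  by rewrite /v0 /fb_step /residual scalerBr opprB addrA addrAC.
have Kpos u : u \in Sg -> u != 0 -> 0 < dot ((Hg + gamma%:M) *m u) u.
  move=> _ u0; rewrite mulmxDl mul_scalar_mx dotDl dotZl -enorm_sqr.
  by rewrite ltr_wpDl ?Hg_psd.2 // mulr_gt0 // exprn_gt0 // enorm_gt0.
move=> /(_ Kpos g_epi2)[E HE].
have [CE CE0 hCE] := enorm_mulmx_bounded E.
have [CA CA0 hCA] := enorm_mulmx_bounded A.
exists (E *m (1%:M + gamma *: (A *m D)) - A *m D) => e e0.
(* [q] bounds the amplification of [err1], whose share of the error is thus [e / 2]; since
   [|k| <= 2 |h|], the tolerance [e / 4] for [err2] yields the other half. *)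
pose q := (CE * gamma + 1) * CA + 1.
have q0 : 0 < q.
  by rewrite ltr_pwDr // mulr_ge0 // addr_ge0 // mulr_ge0 // ltW.
have e1 : 0 < e / (2 * q) by rewrite divr_gt0 // mulr_gt0.
have e2 : 0 < e / 4 by rewrite divr_gt0.
have [d1 d10 Hd1] := HD _ e1; have [d2 d20 Hd2] := HE _ e2.
exists (Num.min d1 (d2 / 2)) => [|h]; first by rewrite lt_min d10 divr_gt0.
rewrite lt_min => /andP[/Hd1 hd1 hd2].
set xi := X (ys + h) - X ys in hd1; set err1 := xi - D *m h in hd1.
pose k := h + gamma *: (A *m xi).
have kh : enorm k <= 2 * enorm h.
  have := gamma_Axmin_lipschitz ys (ys + h); rewrite -/xi [ys + h]addrC addrK.
  have := ler_enormD h (gamma *: (A *m xi)).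
  by rewrite enormZ (gtr0_norm gamma_gt0) -/k; lra.
have vk : ys + h + gamma *: (A *m X (ys + h)) = v0 + k.
  have -> : A *m X (ys + h) = A *m X ys + A *m xi.
    by rewrite -mulmxDr /xi [X ys + _]addrC subrK.
  by rewrite scalerDr addrACA.
have kd2 : enorm k < d2 by lra.
have {}Hd2 := Hd2 k kd2.
rewrite -vk -ZE -(ZE ys : _ = (G v0).1) in Hd2; set err2 := Z _ - _ - _ in Hd2.
have -> : rho (ys + h) - rho ys - (E *m (1%:M + gamma *: (A *m D)) - A *m D) *m h =
   E *m (gamma *: (A *m err1)) + err2 - A *m err1.
  have Zk : Z (ys + h) - Z ys = E *m k + err2 by rewrite /err2 [RHS]addrC subrK.
  rewrite [in LHS]/residual [X in X - _ *m h]subrBB Zk -mulmxBr.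
  exact: linearization_error.
have A1 := ler_enormB (E *m (gamma *: (A *m err1)) + err2) (A *m err1).
have A2 := ler_enormD (E *m (gamma *: (A *m err1))) err2.
have A3 := hCE (gamma *: (A *m err1)).
have A4 := hCA err1.
rewrite enormZ (gtr0_norm gamma_gt0) in A3.
have A5 : CE * (gamma * enorm (A *m err1)) <= CE * (gamma * (CA * enorm err1)).
  by rewrite ler_wpM2l // ler_pM2l.
have A6 : q * enorm err1 <= e / 2 * enorm h.
  apply: (@le_trans _ _ (q * (e / (2 * q) * enorm h))); first by rewrite ler_pM2l.
  by rewrite le_eqVlt; apply/orP; left; apply/eqP; field; rewrite gt_eqF.
have A7 := enorm_ge0 err1.
have A8 : e / 4 * enorm k <= e / 4 * (2 * enorm h) by rewrite ler_pM2l.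
move: A6; rewrite /q; lra.
Qed.

End ResidualDiff.

(** * Consequences of quadratic growth at the strong minimizer *)

Section StrongMinimizer.
Context (ys : 'cV[R]_m) (alpha delta psi_min : R).
Context (alpha_gt0 : 0 < alpha) (delta_gt0 : 0 < delta).
Context (psi_ys : psi ys = psi_min%:E).
Context (growth_near : forall w r, enorm (w - ys) < delta -> (psi w <= r%:E)%E ->
  psi_min + alpha * enorm (w - ys) ^+ 2 <= r).

(** By convexity, the growth at distance [delta / 2] on the segment from [ys] to [w] extends
    linearly up to [w]. *)
Lemma growth_far w r : delta <= enorm (w - ys) -> (psi w <= r%:E)%E ->
  psi_min + alpha * delta / 2 * enorm (w - ys) <= r.
Proof.
set D := enorm (w - ys) => dD wr.
have D0 : 0 < D by apply: lt_le_trans dD.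
pose t := delta / (2 * D).
have tD : t * D = delta / 2 by rewrite /t; field; rewrite gt_eqF.
have t0 : 0 < t by rewrite divr_gt0 // mulr_gt0.
have t1 : t <= 1 / 2 by rewrite -(ler_pM2r D0) tD; lra.
have t01 : 0 <= t <= 1 by apply/andP; split; lra.
have ys_le : (psi ys <= psi_min%:E)%E by rewrite psi_ys.
have := dual_function_convex t01 wr ys_le.
have E : t *: w + (1 - t) *: ys - ys = t *: (w - ys).
  by apply/matrixP => i j; rewrite !mxE; ring.
move=> /growth_near; rewrite E enormZ gtr0_norm // -/D tD => H.
have hd : delta / 2 < delta by have := delta_gt0; lra.
have {}H := H hd.
rewrite -(ler_pM2l t0).
have : alpha * delta / 2 * (t * D) = alpha * (delta / 2) ^+ 2 by rewrite tD; field.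
move: H; set q := (delta / 2) ^+ 2; nra.
Qed.

Lemma psi_min_le w r : (psi w <= r%:E)%E -> psi_min <= r.
Proof.
have [wd|wd] := ltP (enorm (w - ys)) delta.
  move=> /(growth_near wd); apply: le_trans.
  by rewrite lerDl mulr_ge0 ?sqr_ge0 // ltW.
move=> /(growth_far wd); apply: le_trans.
by rewrite lerDl mulr_ge0 ?enorm_ge0 // divr_ge0 // mulr_ge0 // ltW.
Qed.

Lemma psi_min_le_step y : psi_min <= dual_step y.
Proof. by apply: (@psi_min_le (fb_step y)); rewrite dual_function_fb_step. Qed.

Lemma fb_gap_gt0 : 0 < gamma / 2 * (1 - gamma * opnorm A ^+ 2 / mu).
Proof. by rewrite mulr_gt0 ?divr_gt0 // subr_gt0 ltr_pdivrMr // mul1r. Qed.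

Lemma fb_envelope_le_near y :
  fb_envelope y <= psi_min + 1 / (2 * gamma) * enorm (y - ys) ^+ 2.
Proof.
have := fb_envelope_le y ys; rewrite psi_ys lee_fin enorm_sqr.
by rewrite -(opprB y ys) !dot_lin; lra.
Qed.

(** At [ys] the envelope is at most [psi_min], while it exceeds [dual_step ys >= psi_min] by a
    positive multiple of [|rho ys|^2]. *)
Lemma residual_ys : rho ys = 0.
Proof.
have := fb_envelope_le_near ys; rewrite subrr enorm0 expr0n /= mulr0 addr0.
have := dual_step_descent ys; have := psi_min_le_step ys => A1 A2 A3.
apply/dot_eq0/le_anti; rewrite dot_ge0 andbT.
by rewrite -(pmulr_rle0 _ fb_gap_gt0); lra.
Qed.

Lemma fb_step_ys : fb_step ys = ys.
Proof. by rewrite /fb_step residual_ys scaler0 subr0. Qed.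

Lemma zmin_ys : Z ys = A *m X ys.
Proof. by apply/eqP; rewrite -subr_eq0; apply/eqP/residual_ys. Qed.

(** Since [ys] is a subgradient of [g] at [A x(ys)], adding that inequality to the growth of
    [f + <ys, A .>] around [X ys] bounds [|xs - X ys|^2] by a nonpositive number. *)
Lemma xmin_ys xs : minimizers (fun x => f x + g (A *m x))%E xs -> X ys = xs.
Proof.
move=> /(_ (X ys)); rewrite (xmin_tilted ys).1 -zmin_ys (zmin_tilted ys).1.
case fx : (f xs) (f_proper.1 xs) => [r| |] fN; last by rewrite ltxx in fN.
  case gx : (g (A *m xs)) (g_proper.1 (A *m xs)) => [s| |] gN.
  - rewrite -!EFinD lee_fin => H.
    have := @fxmin_le ys xs r; rewrite fx lexx => /(_ isT).
    have := @fb_step_subgradient ys (A *m xs) s; rewrite gx lexx => /(_ isT).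
    rewrite fb_step_ys zmin_ys !dot_lin => A1 A2.
    apply/eqP; rewrite eq_sym -subr_eq0 -enorm_eq0 -sqrf_eq0.
    apply/eqP/le_anti; rewrite sqr_ge0 andbT.
    have m2 : 0 < mu / 2 by rewrite divr_gt0.
    by rewrite -(pmulr_rle0 _ m2) enorm_sqr !dot_lin; lra.
  - by rewrite leNgt ltry.
  - by rewrite ltxx in gN.
case gx : (g (A *m xs)) (g_proper.1 (A *m xs)) => [s| |] gN.
- by rewrite leNgt ltry.
- by rewrite leNgt ltry.
- by rewrite ltxx in gN.
Qed.

(* Error bound: at [fb_step y] the dual function has a subgradient of norm at
   most [2 |rho y|], to be compared with the growth of the dual function. *)
Lemma fb_step_error y : 4 * enorm (rho y) < alpha * delta ->
  alpha * enorm (fb_step y - ys) <= 2 * enorm (rho y).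
Proof.
move=> small; set p := fb_step y.
have sub : dual_step y - psi_min <= enorm (p - ys) * (2 * enorm (rho y)).
  have := dual_step_subgradient y ys; rewrite psi_ys lee_fin -/p.
  have := dot_le (p - ys) (fb_step_grad y).
  have := ler_wpM2l (enorm_ge0 (p - ys)) (fb_step_grad_le y).
  by rewrite -(opprB p ys) dotNl; lra.
have pr : (psi p <= (dual_step y)%:E)%E by rewrite dual_function_fb_step.
have [pd|pd] := ltP (enorm (p - ys)) delta.
  have := growth_near pd pr; set e := enorm (p - ys) in sub * => gr.
  have [->|e0] := eqVneq e 0; first by rewrite mulr0 mulr_ge0 ?enorm_ge0.
  have e_gt0 : 0 < e by rewrite lt_def e0 enorm_ge0.
  by rewrite -(ler_pM2l e_gt0); move: gr; rewrite expr2; lra.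
(* This case is contradictory: the growth rate [alpha * delta / 2] exceeds the slope [2 |rho y|]. *)
have := growth_far pd pr; set e := enorm (p - ys) in sub pd *.
have e_gt0 : 0 < e by apply: lt_le_trans pd.
have := small; rewrite -(ltr_pM2l e_gt0); lra.
Qed.

Lemma residual_error y : 4 * enorm (rho y) < alpha * delta ->
  alpha * enorm (y - ys) <= (2 + alpha * gamma) * enorm (rho y).
Proof.
move=> /fb_step_error; have := ler_enormD (fb_step y - ys) (gamma *: rho y).
have -> : fb_step y - ys + gamma *: rho y = y - ys.
  by rewrite /fb_step addrAC subrK.
rewrite enormZ (gtr0_norm gamma_gt0) -(ler_pM2l alpha_gt0); lra.
Qed.

Lemma residual_near_error : exists2 d, 0 < d &
  forall y, enorm (y - ys) < d ->
    alpha * enorm (y - ys) <= (2 + alpha * gamma) * enorm (rho y).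
Proof.
(* [rho] has Lipschitz constant [3 / gamma], so within this radius [4 |rho y| < alpha * delta]. *)
exists (gamma * alpha * delta / 12) => [|y yd].
  by rewrite divr_gt0 // !mulr_gt0.
apply: residual_error; rewrite -(ltr_pM2l gamma_gt0).
have := residual_lipschitz ys y; rewrite residual_ys subr0; lra.
Qed.

(** The error bound gives [|rho y| >= 2 c |y - ys|] near [ys]; linearizing with tolerance [c] loses
    half of it. *)
Lemma jacobian_injective J : ediff rho ys J ->
  exists2 c, 0 < c & forall w : 'cV[R]_m, c * enorm w <= enorm (J *m w).
Proof.
move=> dJ; have [d d0 Hd] := residual_near_error.
have q0 : 0 < 2 + alpha * gamma by rewrite addr_gt0 // mulr_gt0.
pose c := alpha / (2 + alpha * gamma) / 2.
have c0 : 0 < c by rewrite !divr_gt0.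
exists c => // w; have [d' d'0 Hd'] := dJ c c0.
have [->|w0] := eqVneq w 0; first by rewrite enorm0 mulr0 enorm_ge0.
have w_gt0 : 0 < enorm w by rewrite enorm_gt0.
pose t := Num.min d d' / (2 * enorm w).
have m0 : 0 < Num.min d d' by rewrite lt_min d0.
have t0 : 0 < t by rewrite divr_gt0 // mulr_gt0.
have tw : enorm (t *: w) < Num.min d d'.
  rewrite enormZ gtr0_norm // /t.
  by move: (Num.min d d') m0 => r r0; rewrite invfM mulrA divfK ?gt_eqF //; lra.
move: tw; rewrite lt_min => /andP[td td'].
have := Hd (ys + t *: w); rewrite addrC addKr => /(_ td).
have := Hd' _ td'; rewrite residual_ys subr0 -scalemxAr.
have := ler_enormB (rho (ys + t *: w) - t *: (J *m w)) (- (t *: (J *m w))).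
rewrite opprK subrK enormN !enormZ gtr0_norm //.
move=> A1 A2 A3; rewrite -(ler_pM2l t0).
have A4 : 2 * c * (t * enorm w) <= enorm (rho (ys + t *: w)).
  rewrite -(ler_pM2l q0); apply: le_trans _ A3; rewrite le_eqVlt; apply/orP; left.
  by apply/eqP; rewrite /c; field; rewrite gt_eqF.
lra.
Qed.

Lemma fb_envelope_ge y : psi_min <= fb_envelope y.
Proof.
apply: le_trans (psi_min_le_step y) _; apply: le_trans _ (dual_step_descent y).
by rewrite lerDl mulr_ge0 ?dot_ge0 // ltW // fb_gap_gt0.
Qed.

(** [y - ys] is the sum of [fb_step y - ys], controlled by the growth of [psi], and
    [gamma *: rho y], controlled by the descent gap. The radius [delta / 4] reflects that [fb_step]
    is 4-Lipschitz. *)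
Lemma fb_envelope_growth : exists c d, [/\ 0 < c, 0 < d &
  forall y, enorm (y - ys) < d ->
    psi_min + c * enorm (y - ys) ^+ 2 <= fb_envelope y].
Proof.
set k := gamma / 2 * (1 - gamma * opnorm A ^+ 2 / mu).
have k0 : 0 < k := fb_gap_gt0.
pose k' := k / gamma ^+ 2.
have k'0 : 0 < k' by rewrite divr_gt0 // exprn_gt0.
have m0 : 0 < Num.min alpha k' by rewrite lt_min alpha_gt0.
exists (Num.min alpha k' / 2), (delta / 4); split; rewrite ?divr_gt0 // => y yd.
have := fb_step_lipschitz ys y; rewrite fb_step_ys => lip.
have pd : enorm (fb_step y - ys) < delta by lra.
have pr : (psi (fb_step y) <= (dual_step y)%:E)%E by rewrite dual_function_fb_step.
have := growth_near pd pr; have := dual_step_descent y; rewrite -/k -enorm_sqr.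
have := ler_enormD (fb_step y - ys) (gamma *: rho y).
have -> : fb_step y - ys + gamma *: rho y = y - ys.
  by rewrite /fb_step addrAC subrK.
rewrite enormZ (gtr0_norm gamma_gt0).
have -> : k = k' * gamma ^+ 2 by rewrite /k' divfK // gt_eqF // exprn_gt0.
have := enorm_ge0 (y - ys); have := enorm_ge0 (rho y); have := enorm_ge0 (fb_step y - ys).
move: (enorm (fb_step y - ys)) (enorm (y - ys)) (enorm (rho y)).
move=> a b r a0 r0 b0 ab H1 H2.
have : b ^+ 2 <= (a + gamma * r) ^+ 2.
  by rewrite ler_pXn2r ?nnegrE // (le_trans b0).
have : 0 <= (a - gamma * r) ^+ 2 by rewrite sqr_ge0.
have ma : Num.min alpha k' <= alpha by rewrite ge_min lexx.
have mk : Num.min alpha k' <= k' by rewrite ge_min lexx orbT.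
have := ler_wpM2r (sqr_ge0 a) ma; have := ler_wpM2r (sqr_ge0 (gamma * r)) mk.
move: m0; set q := Num.min alpha k' => q0 B1 B2 B3 B4.
have B5 : q / 2 * b ^+ 2 <= q / 2 * (2 * a ^+ 2 + 2 * (gamma * r) ^+ 2).
  by rewrite ler_wpM2l ?divr_ge0 ?(ltW q0) //; lra.
lra.
Qed.

(** * Convergence of the iterates and superlinear rates *)

Section Iterates.
Context (beta : R) (x : nat -> 'cV[R]_n) (z y d : nat -> 'cV[R]_m) (tau : nat -> R).
Context (xzy_nama : nama f g A gamma beta x z y d tau).
Context (not_solved : forall k, A *m x k <> z k).

Local Notation yt k := (trial A gamma (x k) (z k) (y k) (d k) (tau k)).

Lemma nama_fb_step k : y k.+1 = fb_step (yt k).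
Proof.
by rewrite (nama_y xzy_nama) /fb_step /residual -scalerN opprB.
Qed.

Lemma nama_envelope_le k : fb_envelope (yt k) <= fb_envelope (y k).
Proof.
have [i [-> + _]] := nama_tau xzy_nama k.
rewrite /= (nama_x xzy_nama) (nama_z xzy_nama) !aug_lagrangian_envelope lee_fin.
by rewrite lerN2.
Qed.

Lemma fb_envelope_fb_step v : fb_envelope (fb_step v) <= dual_step v.
Proof.
have := fb_envelope_le (fb_step v) (fb_step v).
by rewrite dual_function_fb_step lee_fin subrr dot0r mulr0 subr0.
Qed.

Lemma nama_envelope_decrease k :
  fb_envelope (y k.+1) + gamma / 2 * (1 - gamma * opnorm A ^+ 2 / mu) *
    enorm (rho (yt k)) ^+ 2 <= fb_envelope (y k).
Proof.
apply: le_trans _ (nama_envelope_le k).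
apply: le_trans _ (dual_step_descent (yt k)).
by rewrite enorm_sqr nama_fb_step lerD2r fb_envelope_fb_step.
Qed.

(** The envelope values decrease and are bounded below, hence converge; their successive differences
    dominate [|rho|^2]. *)
Lemma nama_residual_cvg e : 0 < e ->
  \forall k \near \oo, enorm (rho (yt k)) < e.
Proof.
move=> e0; have := nama_envelope_decrease; have := fb_gap_gt0.
move: (gamma / 2 * _) => q q0 dec.
have qe : 0 < q * e ^+ 2 / 2 by rewrite divr_gt0 // mulr_gt0 // exprn_gt0.
have [l ul] : exists l : R, fb_envelope (y k) @[k --> \oo] --> l.
  have ucvg : cvgn (fun k => fb_envelope (y k)).
    apply: nonincreasing_is_cvgn.
      apply/nonincreasing_seqP => k; apply: le_trans (dec k).
      by rewrite lerDl mulr_ge0 ?sqr_ge0 // ltW.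
    by exists psi_min => _ [k _ <-]; exact: fb_envelope_ge.
  by eexists; exact: ucvg.
have near_l : \forall k \near \oo, `|l - fb_envelope (y k)| < q * e ^+ 2 / 2.
  by move/cvgrPdist_lt : ul => /(_ _ qe).
have near_lS := @near_shiftS (fun k => `|l - fb_envelope (y k)| < q * e ^+ 2 / 2) near_l.
apply: filterS2 near_l near_lS => k B1 B2.
rewrite -(@ltr_pXn2r _ 2) ?nnegrE ?enorm_ge0 ?(ltW e0) // -(ltr_pM2l q0).
move: (dec k) (ltrNnormlW B1) (ltr_normlW B2).
move: (fb_envelope (y k)) (fb_envelope (y k.+1)) (enorm _ ^+ 2) (e ^+ 2).
by move=> a b r s {}B1 {}B2 B3; lra.
Qed.

(** [fb_step_error] at the trial point bounds the distance of the next iterate to [ys]. *)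
Lemma nama_cvg e : 0 < e -> \forall k \near \oo, enorm (y k - ys) < e.
Proof.
move=> e0.
have m0 : 0 < Num.min (alpha * delta / 4) (alpha * e / 2).
  by rewrite lt_min !divr_gt0 // mulr_gt0.
apply: near_inftyS; near=> k.
have : enorm (rho (yt k)) < Num.min (alpha * delta / 4) (alpha * e / 2).
  by near: k; exact: nama_residual_cvg.
rewrite nama_fb_step; move: (yt k) => v; rewrite lt_min => /andP[A1 A2].
have A3 : 4 * enorm (rho v) < alpha * delta by lra.
by rewrite -(ltr_pM2l alpha_gt0); apply: le_lt_trans (fb_step_error A3) _; lra.
Unshelve. all: by end_near. Qed.

Lemma nama_neq k : 0 < enorm (y k - ys).
Proof.
rewrite enorm_gt0 subr_eq0; apply/eqP => yk; apply: (not_solved (k := k)).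
by rewrite (nama_x xzy_nama) (nama_z xzy_nama) yk zmin_ys.
Qed.

Context (B : nat -> 'M[R]_m) (J : 'M[R]_m).
Context (B_unit : forall k, B k \in unitmx)
  (d_def : forall k, d k = invmx (B k) *m (A *m x k - z k)).
Context (rho_diff : ediff rho ys J).
Context (dennis_more :
  enorm ((B k - J) *m d k) / enorm (d k) @[k --> \oo] --> 0).

(** As [B k *m d k = - rho (y k)], [J] maps [y k + d k - ys] to the sum of a linearization error and
    the Dennis-More defect; the lower bound on [J] then applies. *)
Lemma direction_superlinear e : 0 < e ->
  \forall k \near \oo, enorm (y k + d k - ys) <= e * enorm (y k - ys).
Proof.
move=> e0; have [c c0 Jc] := jacobian_injective rho_diff.
(* The defect is at most [eta |d k|], with [|d k| <= |y k + d k - ys| + |y k - ys|]: [c / 2] absorbs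
   the first term on the left, and [c * e / 4] serves the second and the linearization error. *)
pose eta := Num.min (c / 2) (c * e / 4).
have eta0 : 0 < eta by rewrite lt_min !divr_gt0 // mulr_gt0.
have eta1 : eta <= c / 2 by rewrite ge_min lexx.
have eta2 : eta <= c * e / 4 by rewrite ge_min lexx orbT.
have [r r0 Hr] := rho_diff eta0.
have DM : \forall k \near \oo, enorm ((B k - J) *m d k) / enorm (d k) < eta.
  move/cvgrPdist_lt : dennis_more => /(_ _ eta0); apply: filterS => k.
  by rewrite sub0r normrN ger0_norm // divr_ge0 ?enorm_ge0.
near=> k.
have d0 : 0 < enorm (d k).
  rewrite enorm_gt0; apply/eqP => dk; apply: (not_solved (k := k)).
  apply/eqP; rewrite -subr_eq0; apply/eqP.
  by rewrite -[LHS](mulKVmx (B_unit k)) -d_def dk mulmx0.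
have A1 : enorm ((B k - J) *m d k) <= eta * enorm (d k).
  by rewrite -ler_pdivrMr // ltW //; near: k.
have A2 : enorm (y k - ys) < r by near: k; exact: nama_cvg.
have := Hr _ A2; rewrite residual_ys subr0 [ys + _]addrC subrK => A3.
have Bd : B k *m d k = - rho (y k).
  rewrite d_def mulKVmx // /residual opprB.
  by rewrite (nama_x xzy_nama) (nama_z xzy_nama).
have A4 := Jc (y k + d k - ys).
have JE : J *m (y k + d k - ys) =
    - (rho (y k) - J *m (y k - ys)) - (B k - J) *m d k.
  rewrite mulmxBl Bd [y k + d k - ys]addrAC mulmxDr.
  move: (J *m (y k - ys)) (J *m d k) (rho (y k)) => a b r'.
  by rewrite opprB opprD !opprK addrA subrK.
have A5 := ler_enormB (- (rho (y k) - J *m (y k - ys))) ((B k - J) *m d k).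
rewrite -JE enormN in A5.
have dE : y k + d k - ys - (y k - ys) = d k.
  by rewrite [y k + _ - ys]addrAC [LHS]addrC addKr.
have A6 := ler_enormB (y k + d k - ys) (y k - ys); rewrite dE in A6.
have := enorm_ge0 (y k + d k - ys); have := enorm_ge0 (y k - ys).
move: (enorm (d k)) (enorm (y k + d k - ys)) (enorm (y k - ys)) A1 A3 A4 A5 A6
  => dk D a A1 A3 A4 A5 A6 a_ge0 D_ge0.
have A7 : eta * dk <= eta * (D + a) by rewrite ler_pM2l.
have A8 : eta * D <= c / 2 * D by rewrite ler_wpM2r.
have A9 : eta * a <= c * e / 4 * a by rewrite ler_wpM2r.
by rewrite -(ler_pM2l c0); lra.
Unshelve. all: by end_near. Qed.

Lemma direction_envelope_le e : 0 < e -> \forall k \near \oo,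
  fb_envelope (y k + d k) <= psi_min + e * enorm (y k - ys) ^+ 2.
Proof.
move=> e0; have ge0 : 0 < 2 * gamma * e by rewrite !mulr_gt0.
(* The factor gets squared; being at most [1], its square stays below [2 * gamma * e]. *)
have m0 : 0 < Num.min 1 (2 * gamma * e) by rewrite lt_min ltr01.
near=> k.
have A1 : enorm (y k + d k - ys) <= Num.min 1 (2 * gamma * e) * enorm (y k - ys).
  by near: k; exact: direction_superlinear.
apply: (le_trans (fb_envelope_le_near _)); rewrite lerD2l.
apply: (@le_trans _ _ (1 / (2 * gamma) *
    (2 * gamma * e * enorm (y k - ys) ^+ 2))); last first.
  by rewrite le_eqVlt; apply/orP; left; apply/eqP; field; rewrite gt_eqF.
rewrite ler_pM2l ?divr_gt0 ?mulr_gt0 //.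
apply: (@le_trans _ _ ((Num.min 1 (2 * gamma * e) * enorm (y k - ys)) ^+ 2)).
  by rewrite ler_pXn2r ?nnegrE ?mulr_ge0 ?enorm_ge0 ?(ltW m0).
rewrite exprMn ler_wpM2r ?sqr_ge0 // expr2.
apply: (@le_trans _ _ (1 * Num.min 1 (2 * gamma * e))).
  by rewrite ler_pM2r // ge_min lexx.
by rewrite mul1r ge_min lexx orbT.
Unshelve. all: by end_near. Qed.

(** The envelope exceeds [psi_min] by [o(|y k - ys|^2)] at [y k + d k] but by a fixed multiple of
    [|y k - ys|^2] at [y k], so exponent [0] passes the line search. *)
Lemma unit_step : \forall k \near \oo, tau k = 1.
Proof.
have [c [r [c0 r0 growth]]] := fb_envelope_growth.
near=> k.
have [i [ti _ Hi]] := nama_tau xzy_nama k.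
case: i => [|i] in ti Hi *; first by rewrite ti expr0.
case: (Hi 0%N) => //=; rewrite expr0 /trial scale1r subrr mulr0 scale0r addr0.
rewrite (nama_x xzy_nama) (nama_z xzy_nama) !aug_lagrangian_envelope lee_fin.
rewrite lerN2; apply: le_trans _ (growth _ _).
  by near: k; exact: direction_envelope_le.
by near: k; exact: nama_cvg.
Unshelve. all: by end_near. Qed.

Lemma nama_unit_step : \forall k \near \oo, y k.+1 = fb_step (y k + d k).
Proof.
near=> k; rewrite nama_fb_step.
have -> : tau k = 1 by near: k; exact: unit_step.
by rewrite /trial scale1r subrr mulr0 scale0r addr0.
Unshelve. all: by end_near. Qed.

Lemma nama_superlinear e : 0 < e ->
  \forall k \near \oo, enorm (y k.+1 - ys) <= e * enorm (y k - ys).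
Proof.
move=> e0; have e4 : 0 < e / 4 by rewrite divr_gt0.
near=> k.
have -> : y k.+1 = fb_step (y k + d k) by near: k; exact: nama_unit_step.
have := fb_step_lipschitz ys (y k + d k); rewrite fb_step_ys.
have : enorm (y k + d k - ys) <= e / 4 * enorm (y k - ys).
  by near: k; exact: direction_superlinear.
lra.
Unshelve. all: by end_near. Qed.

Lemma nama_enorm_cvg : enorm (y k - ys) @[k --> \oo] --> 0.
Proof.
apply/cvgrPdist_lt => e e0; apply: filterS (nama_cvg e0) => k.
by rewrite sub0r normrN ger0_norm ?enorm_ge0.
Qed.

Lemma nama_q_superlinear C : 0 < C ->
  q_superlinear (fun k => (C * enorm (y k - ys))%:E).
Proof.
move=> C0; apply: (@q_superlinear_near _ _ (fun k => C * enorm (y k - ys))).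
- exact: nearW.
- by apply: nearW => k; rewrite mulr_gt0 // nama_neq.
- by rewrite -(mulr0 C); apply: cvgMl_tmp; exact: nama_enorm_cvg.
- move=> e e0; apply: filterS (nama_superlinear e0) => k.
  by rewrite mulrCA ler_pM2l.
Qed.

(** The value at [y k.+1] lies below the envelope at [y k + d k], so its gap is [o(|y k - ys|^2)],
    while the gap at [y k] is at least [alpha |y k - ys|^2]. *)
Lemma dual_value_q_superlinear :
  q_superlinear (fun k => (psi (y k) - ereal_inf (range psi))%E).
Proof.
have -> : ereal_inf (range psi) = psi_min%:E.
  apply/le_anti/andP; split.
    by rewrite -psi_ys; apply: ereal_inf_lbound; exists ys.
  apply: le_ereal_inf_tmp => _ [w _ <-].
  case pw : (psi w) => [r| |]; last 2 first.
  - by rewrite leey.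
  - have /psi_min_le : (psi w <= (psi_min - 1)%R%:E)%E by rewrite pw leNye.
    by rewrite lerBrDl gerDr ler10.
  by rewrite lee_fin; apply: (@psi_min_le w); rewrite pw.
(* [psi (y 0)] may be [+oo]; from index [1] on the iterates are forward-backward steps, where [psi]
   is finite. *)
pose v k := fine (psi (y k)) - psi_min.
have vE k : psi (y k.+1) = (v k.+1 + psi_min)%:E.
  by rewrite /v nama_fb_step dual_function_fb_step /= subrK.
have vS : \forall k \near \oo, v k.+1 <= fb_envelope (y k + d k) - psi_min.
  near=> k; rewrite /v.
  have -> : y k.+1 = fb_step (y k + d k) by near: k; exact: nama_unit_step.
  rewrite dual_function_fb_step /= lerD2r.
  apply: le_trans _ (dual_step_descent _).
  by rewrite lerDl mulr_ge0 ?dot_ge0 // ltW // fb_gap_gt0.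
have v_ge : \forall k \near \oo, alpha * enorm (y k - ys) ^+ 2 <= v k.
  have [N _ H] := nama_cvg delta_gt0.
  exists N.+1 => // -[//|k] /= Nk.
  have /growth_near := H k.+1 (leqW Nk).
  move=> /(_ (v k.+1 + psi_min)); rewrite vE lexx => /(_ isT); lra.
have v_le e : 0 < e -> \forall k \near \oo, v k.+1 <= e * enorm (y k - ys) ^+ 2.
  move=> e0; near=> k.
  have A1 : v k.+1 <= fb_envelope (y k + d k) - psi_min by near: k.
  have A2 : fb_envelope (y k + d k) <= psi_min + e * enorm (y k - ys) ^+ 2.
    by near: k; exact: direction_envelope_le.
  lra.
apply: (@q_superlinear_near _ _ v).
- by exists 1%N => // -[//|k] _ /=; rewrite vE -EFinB addrK.
- near=> k; apply: (@lt_le_trans _ _ (alpha * enorm (y k - ys) ^+ 2)).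
    by rewrite mulr_gt0 // exprn_gt0 // nama_neq.
  by near: k.
- rewrite -(cvg_shiftS v); apply/cvgrPdist_le => e e0; near=> k => /=.
  have A1 : v k.+1 <= e * enorm (y k - ys) ^+ 2 by near: k; exact: v_le.
  have A2 : enorm (y k - ys) < 1 by near: k; exact: nama_cvg.
  have A3 : alpha * enorm (y k.+1 - ys) ^+ 2 <= v k.+1.
    by near: k; exact: (near_shiftS v_ge).
  have A4 : 0 <= v k.+1.
    by apply: le_trans A3; rewrite mulr_ge0 ?sqr_ge0 // ltW.
  rewrite sub0r normrN ger0_norm // (le_trans A1) // ger_pMr //.
  by rewrite expr_le1 ?enorm_ge0 // ltW.
- move=> e e0; have ea : 0 < e * alpha by rewrite mulr_gt0.
  near=> k.
  have A1 : v k.+1 <= e * alpha * enorm (y k - ys) ^+ 2.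
    by near: k; exact: v_le.
  have A2 : alpha * enorm (y k - ys) ^+ 2 <= v k by near: k.
  by have := ler_wpM2l (ltW e0) A2; lra.
Unshelve. all: by end_near. Qed.

Lemma primal_r_superlinear :
  r_superlinear (fun k => enorm (x k - X ys)).
Proof.
(* Adding [1] keeps the constant positive when [A = 0]. *)
have C0 : 0 < opnorm A / mu + 1.
  by rewrite ltr_wpDl // divr_ge0 ?opnorm_ge0 // ltW.
exists (fun k => (opnorm A / mu + 1) * enorm (y k - ys)); last first.
  exact: nama_q_superlinear.
move=> k; rewrite (nama_x xzy_nama) -(ler_pM2l mu_gt0).
apply: le_trans (xmin_lipschitz _ _) _.
rewrite mulrA mulrDr mulr1 mulrCA mulfV ?gt_eqF // mulr1.
by rewrite ler_wpM2r ?enorm_ge0 // lerDl ltW.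
Qed.

End Iterates.

End StrongMinimizer.

End ForwardBackward.

(** With [v = H *m u] and [N = |v|^2], the form at [q *: u - N *: v] equals [- N ^+ 2 * (q + 1)],
    which forces [N = 0]. *)
Lemma psd_eq0 (R : realType) n (H : 'M[R]_n) (u : 'cV[R]_n) :
  symmetric_psd H -> dot (H *m u) u = 0 -> H *m u = 0.
Proof.
move=> [HT H0] Hu.
have := H0 (H *m u); set v := H *m u => q0.
have HC : dot (H *m v) u = dot v v by rewrite dotC dot_mulmxr HT.
pose q := dot (H *m v) v + 1.
have q1 : 0 < q by rewrite ltr_pwDr.
have N0 := dot_ge0 v; set N := dot v v in HC N0 *.
apply: dot_eq0; apply/le_anti; rewrite dot_ge0 andbT -/N.
have := H0 (q *: u - N *: v).
rewrite mulmxBr -!scalemxAr -/v !dot_lin Hu HC -/N.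
have -> : dot (H *m v) v = q - 1 by rewrite /q addrK.
rewrite mulr0 mulr0 => H1.
have H2 : 0 <= - (N * N * (q + 1)) by rewrite -/N in H1 *; lra.
have H3 : N * N <= 0.
  by move: H2; rewrite oppr_ge0 pmulr_lle0 // addr_gt0.
nra.
Qed.

Theorem mainTheorem9 (R : realType) (n m : nat) (A : 'M[R]_(m, n))
  (f : 'cV[R]_n -> \bar R) (g : 'cV[R]_m -> \bar R) (mu : R)
  (f_proper : eproper f) (f_closed : lower_semicontinuous f)
  (mu_gt0 : 0 < mu) (f_strong : strongly_convex mu f)
  (g_proper : eproper g) (g_closed : lower_semicontinuous g)
  (g_convex : econvex g)
  (feasible : exists x, (f x < +oo)%E /\ (g (A *m x) < +oo)%E)
  (xs : 'cV[R]_n) (xs_min : minimizers (fun x => f x + g (A *m x))%E xs)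
  (ys : 'cV[R]_m) (ys_min : strong_minimizer (dual_function f g A) ys)
  (f_strict : \forall x \near xs,
     (f x < +oo)%E -> strictly_twice_epi_diff f x)
  (Sf : {vspace 'cV[R]_n}) (Hf : 'M[R]_n) (Hf_psd : symmetric_psd Hf)
  (Hf_range : mxrange Hf = [set` Sf])
  (Hf_ker : mxker Hf = orthogonal_compl Sf)
  (f_epi2 : is_epi_derivative2 f xs (- (A^T *m ys)) (gen_quadratic Hf Sf))
  (g_strict : strictly_twice_epi_diff_for g (A *m xs) ys)
  (Sg : {vspace 'cV[R]_m}) (Hg : 'M[R]_m) (Hg_psd : symmetric_psd Hg)
  (Hg_range : mxrange Hg `<=` [set` Sg])
  (Hg_ker : orthogonal_compl Sg `<=` mxker Hg)
  (g_epi2 : is_epi_derivative2 g (A *m xs) ys (gen_quadratic Hg Sg))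
  (* gamma < mu / |A|^2, the bound being +oo when A = 0 *)
  (gamma : R) (gamma_gt0 : 0 < gamma)
  (gamma_lt : (gamma%:E < mu%:E / (opnorm A ^+ 2)%:E)%E)
  (beta : R) (beta_gt0 : 0 < beta) (beta_lt1 : beta < 1)
  (x : nat -> 'cV[R]_n) (z y d : nat -> 'cV[R]_m) (tau : nat -> R)
  (xzy_nama : nama f g A gamma beta x z y d tau)
  (not_solved : forall k, A *m x k <> z k)
  (B : nat -> 'M[R]_m) (B_unit : forall k, B k \in unitmx)
  (d_def : forall k, d k = invmx (B k) *m (A *m x k - z k))
  (dennis_more :
     enorm ((B k - cjacobian (residual f g A gamma) ys) *m d k) / enorm (d k)
       @[k --> \oo] --> 0) :
  [/\ enorm (y k + d k - ys) / enorm (y k - ys) @[k --> \oo] --> 0,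
      \forall k \near \oo, tau k = 1,
      q_superlinear (fun k => (dual_function f g A (y k)
                       - ereal_inf (range (dual_function f g A)))%E),
      q_superlinear (fun k => (enorm (y k - ys))%:E) &
      r_superlinear (fun k => enorm (x k - xs))].
Proof.
have small : gamma * opnorm A ^+ 2 < mu.
  have [->|A0] := eqVneq (opnorm A ^+ 2) 0; first by rewrite mulr0.
  have Ap : 0 < opnorm A ^+ 2 by rewrite lt_def A0 sqr_ge0.
  by move: gamma_lt; rewrite inver (negbTE A0) -EFinM lte_fin ltr_pdivlMr.
have [alpha alpha_gt0 /nbhs_enormP[delta delta_gt0 growth]] := ys_min.
have [psi_min psi_ys] : exists a, dual_function f g A ys = a%:E.
  (* Growth at [ys] itself reads [0 <= psi ys - psi ys], whose right side is [-oo] for infinite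
     values. *)
  have := growth ys; rewrite subrr enorm0 => /(_ delta_gt0).
  rewrite expr0n mulr0; case: (dual_function f g A ys) => [a| |] //=.
  by exists a.
have growth_near w r : enorm (w - ys) < delta ->
    (dual_function f g A w <= r%:E)%E -> psi_min + alpha * enorm (w - ys) ^+ 2 <= r.
  move=> /growth; rewrite psi_ys leeBrDr // -EFinD => H1 H2.
  by have := le_trans H1 H2; rewrite lee_fin addrC.
have XE : xmin f A ys = xs.
  exact: (xmin_ys
    f_proper f_closed mu_gt0 f_strong g_proper g_closed g_convex
    gamma_gt0 small alpha_gt0 delta_gt0 psi_ys growth_near xs_min).
have ZE := zmin_ys f_proper f_closed mu_gt0 f_strong g_proper g_closed g_convex
  gamma_gt0 small alpha_gt0 delta_gt0 psi_ys growth_near.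
have YE := fb_step_ys f_proper f_closed mu_gt0 f_strong g_proper g_closed g_convex
  gamma_gt0 small alpha_gt0 delta_gt0 psi_ys growth_near.
have Hf_pos u : u \in Sf -> u != 0 -> 0 < dot (Hf *m u) u.
  (* A vector of [Sf] on which the form vanishes lies in the kernel of [Hf], hence is orthogonal to
     itself. *)
  move=> uS u0; rewrite lt_def Hf_psd.2 andbT; apply: contra_neq u0 => Hu.
  have : mxker Hf u by exact: psd_eq0.
  by rewrite Hf_ker => /(_ _ uS)/dot_eq0.
have f2 : is_epi_derivative2 f (xmin f A ys) (- (A^T *m ys)) (gen_quadratic Hf Sf).
  by rewrite XE.
have g2 : is_epi_derivative2 g (zmin f g A gamma ys) (fb_step A f g gamma ys)
    (gen_quadratic Hg Sg).
  by rewrite ZE XE YE.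
have [J dJ] := residual_ediff f_proper f_closed mu_gt0 f_strong g_proper g_closed
  g_convex gamma_gt0 small Hf_psd.1 Hf_pos f2 Hg_psd g2.
rewrite (ediff_cjacobian dJ) in dennis_more.
have dir e (e0 : 0 < e) := direction_superlinear
    f_proper f_closed mu_gt0 f_strong g_proper g_closed g_convex
    gamma_gt0 small alpha_gt0 delta_gt0 psi_ys growth_near
    xzy_nama not_solved B_unit d_def dJ dennis_more e0.
split.
- apply/cvgrPdist_le => e e0; apply: filterS (dir e e0) => k.
  rewrite sub0r normrN ger0_norm ?divr_ge0 ?enorm_ge0 //.
  by rewrite ler_pdivrMr //; exact: (nama_neq
    f_proper f_closed mu_gt0 f_strong g_proper g_closed g_convex
    gamma_gt0 small alpha_gt0 delta_gt0 psi_ys growth_near xzy_nama not_solved).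
- exact: (unit_step
    f_proper f_closed mu_gt0 f_strong g_proper g_closed g_convex
    gamma_gt0 small alpha_gt0 delta_gt0 psi_ys growth_near
    xzy_nama not_solved B_unit d_def dJ dennis_more).
- exact: (dual_value_q_superlinear
    f_proper f_closed mu_gt0 f_strong g_proper g_closed g_convex
    gamma_gt0 small alpha_gt0 delta_gt0 psi_ys growth_near
    xzy_nama not_solved B_unit d_def dJ dennis_more).
- have := nama_q_superlinear
    f_proper f_closed mu_gt0 f_strong g_proper g_closed g_convex
    gamma_gt0 small alpha_gt0 delta_gt0 psi_ys growth_near
    xzy_nama not_solved B_unit d_def dJ dennis_more ltr01.
  by under eq_fun do rewrite mul1r.
- rewrite -XE.
  exact: (primal_r_superlinear
    f_proper f_closed mu_gt0 f_strong g_proper g_closed g_convex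
    gamma_gt0 small alpha_gt0 delta_gt0 psi_ys growth_near
    xzy_nama not_solved B_unit d_def dJ dennis_more).
Qed.
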